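(* Let $k$ be an infinite field, let $A$ and $B$ be finite dimensional $k$-algebras, and let $\phi\colon A\to B$ be a $k$-algebra extension, i.e. a homomorphism of $k$-algebras. Then the following statements hold. (1) If $\phi$ is a split extension and $B$ is derived-discrete over $k$, then $A$ is derived-discrete over $k$. (2) If $\phi$ is a separable extension such that $B_A$ ($B$ regarded as a right $A$-module via $\phi$) is a projective right $A$-module, and $A$ is derived-discrete over $k$, then $B$ is derived-discrete over $k$.
   Context: All functors are $k$-linear. For a finite dimensional $k$-algebra $A$, $A\text{-mod}$ is the category of finitely generated left $A$-modules and $\mathbf{D}^b(A\text{-mod})$ its bounded derived category; $[X]$ denotes the isomorphism class of $X$ in it. Let $\mathbb{N}^{(\mathbb{Z})}$ be the set of vectors $\underline{n}=(n_i)_{i\in\mathbb{Z}}$ of natural numbers with only finitely many nonzero entries. For $X\in\mathbf{D}^b(A\text{-mod})$ put $\underline{\dim}_kX=(\dim_kH^i(X))_{i\in\mathbb{Z}}\in\mathbb{N}^{(\mathbb{Z})}$. Derived-discrete: $A$ is derived-discrete over $k$ if for every $\underline{n}\in\mathbb{N}^{(\mathbb{Z})}$ the set $\{[X]\in\mathbf{D}^b(A\text{-mod})\mid\underline{\dim}_kX=\underline{n}\}$ is finite. Separable functor: a functor $F\colon\mathcal{C}\to\mathcal{D}$ is separable if for all objects $X,Y$ of $\mathcal{C}$ there is a map $H_{X,Y}\colon\mathrm{Hom}_{\mathcal{D}}(F(X),F(Y))\to\mathrm{Hom}_{\mathcal{C}}(X,Y)$, natural in $X$ and $Y$, such that $H_{X,Y}(F(f))=f$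 for all $f\in\mathrm{Hom}_{\mathcal{C}}(X,Y)$. Split and separable extensions: an algebra homomorphism $\phi\colon A\to B$ is a split extension if the functor $B\otimes_A-\colon A\text{-mod}\to B\text{-mod}$ is separable, and a separable extension if the restriction functor $\mathrm{Hom}_B(B,-)\colon B\text{-mod}\to A\text{-mod}$ is separable. *)

(* Defs.v *)
From HB Require Import structures.
From mathcomp Require Import all_boot all_order all_algebra all_field.
From mathcomp Require Import boolp classical_sets functions cardinality.

Set Implicit Arguments.
Unset Strict Implicit.
Unset Printing Implicit Defensive.

Import GRing.Theory.
Local Open Scope ring_scope.
Local Open Scope quotient_scope.

(** * Categories, functors, separable functors *)

Record category := Category {
  ob :> Type;
  hom : ob -> ob -> Type;
  idm : forall X, hom X X;
  comp : forall X Y Z, hom Y Z -> hom X Y -> hom X Z;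
  comp1m : forall X Y (f : hom X Y), comp (idm Y) f = f;
  compm1 : forall X Y (f : hom X Y), comp f (idm X) = f;
  compA : forall X Y Z W (f : hom X Y) (g : hom Y Z) (h : hom Z W),
    comp h (comp g f) = comp (comp h g) f }.

Arguments hom {c} X Y.
Arguments idm {c} X.
Arguments comp {c X Y Z} g f.

Record functor (C D : category) := Functor {
  fob :> C -> D;
  fmap : forall X Y : C, hom X Y -> hom (fob X) (fob Y);
  fmap1 : forall X : C, fmap (idm X) = idm (fob X);
  fmap_comp : forall (X Y Z : C) (f : hom X Y) (g : hom Y Z),
    fmap (comp g f) = comp (fmap g) (fmap f) }.

Arguments fmap {C D} F {X Y} f : rename.

Definition separable_functor (C D : category) (F : functor C D) : Prop :=
  exists H : forall X Y : C, hom (F X) (F Y) -> hom X Y,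
    (forall (X X' Y Y' : C) (f : hom X' X) (g : hom Y Y') (h : hom (F X) (F Y)),
       H _ _ (comp (fmap F g) (comp h (fmap F f))) = comp g (comp (H _ _ h) f))
    /\ (forall (X Y : C) (f : hom X Y), H _ _ (fmap F f) = f).

(** * Finitely generated left modules *)

Definition finitely_generated (A : pzRingType) (M : lmodType A) : Prop :=
  exists (n : nat) (g : 'I_n -> M),
    forall x : M, exists a : 'I_n -> A, x = \sum_(i < n) a i *: g i.

Record fgmod (A : pzRingType) := FgMod {
  fgmod_sort :> lmodType A;
  fgmodP : finitely_generated fgmod_sort }.

Lemma linear_eq (A : pzRingType) (M N : lmodType A) (f g : {linear M -> N}) :
  f =1 g -> f = g.
Proof.
move=> E; have {E} : (f : M -> N) = g by apply/funext.
case: f => f cf; case: g => g cg /= E; subst g; congr GRing.Linear.Pack.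
case: cf cg => [[f1] [f2]] [[g1] [g2]].
by rewrite (Prop_irrelevance f1 g1) (Prop_irrelevance f2 g2).
Qed.

Definition fgmod_cat (A : pzRingType) : category.
Proof.
refine (@Category (fgmod A) (fun M N => {linear M -> N})
  (fun M => idfun) (fun M N P g f => g \o f) _ _ _) => *; exact: linear_eq.
Defined.

(** * Restriction of scalars and extension of scalars *)

Section Scalars.
Variables (A B : pzRingType) (phi : {rmorphism A -> B}).

Definition restrict of {rmorphism A -> B} := fun M : lmodType B => M : Type.

Section RestrictModule.
Variable M : lmodType B.
Local Notation rM := (restrict phi M).

HB.instance Definition _ := GRing.Zmodule.copy rM M.

Definition restrict_scale (a : A) (x : rM) : rM := phi a *: (x : M).

Lemma restrict_scaleA a b x :
  restrict_scale a (restrict_scale b x) = restrict_scale (a * b) x.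
Proof. by rewrite /restrict_scale scalerA rmorphM. Qed.

Lemma restrict_scale1 : left_id 1 restrict_scale.
Proof. by move=> x; rewrite /restrict_scale rmorph1 scale1r. Qed.

Lemma restrict_scaleDr : right_distributive restrict_scale +%R.
Proof. by move=> a x y; rewrite /restrict_scale scalerDr. Qed.

Lemma restrict_scaleDl x :
  {morph restrict_scale^~ x : a b / a + b}.
Proof. by move=> a b; rewrite /restrict_scale rmorphD scalerDl. Qed.

HB.instance Definition _ := GRing.Zmodule_isLmodule.Build A rM
  restrict_scaleA restrict_scale1 restrict_scaleDr restrict_scaleDl.

Lemma restrict_scaleE (a : A) (x : M) : a *: (x : rM) = phi a *: x.
Proof. by []. Qed.
End RestrictModule.

Definition restrict_map (M N : lmodType B) (f : {linear M -> N}) :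
  restrict phi M -> restrict phi N := f.

Lemma restrict_map_linear (M N : lmodType B) (f : {linear M -> N}) :
  linear (restrict_map f).
Proof. by move=> a x y; rewrite /restrict_map linearP. Qed.

HB.instance Definition _ (M N : lmodType B) (f : {linear M -> N}) :=
  GRing.isLinear.Build A (restrict phi M) (restrict phi N) *:%R
    (restrict_map f) (restrict_map_linear f).

(* B as a right A-module is represented as a left module over the converse
   ring A^c. *)
Definition right_regular of {rmorphism A -> B} : Type := B.
Local Notation BA := (right_regular phi).

HB.instance Definition _ := GRing.Zmodule.copy BA B.

Definition right_scale (a : A^c) (b : BA) : BA := (b : B) * phi a.

Lemma right_scaleA a b x :
  right_scale a (right_scale b x) = right_scale (a * b) x.
Proof. by rewrite /right_scale -mulrA -rmorphM. Qed.

Lemma right_scale1 : left_id 1 right_scale.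
Proof. by move=> x; rewrite /right_scale rmorph1 mulr1. Qed.

Lemma right_scaleDr : right_distributive right_scale +%R.
Proof. by move=> a x y; rewrite /right_scale mulrDl. Qed.

Lemma right_scaleDl x : {morph right_scale^~ x : a b / a + b}.
Proof. by move=> a b; rewrite /right_scale rmorphD mulrDr. Qed.

HB.instance Definition _ := GRing.Zmodule_isLmodule.Build A^c BA
  right_scaleA right_scale1 right_scaleDr right_scaleDl.

Section Tensor.
Variable M : lmodType A.

(* The formal sum b_1 (x) m_1 + ... + b_r (x) m_r is the sequence
   [:: (b_1, m_1); ...; (b_r, m_r)]; B (x)_A M is the quotient of the formal
   sums by the congruence generated by the bilinearity relations. *)
Inductive tensor_eq : seq (B * M) -> seq (B * M) -> Prop :=
| tensor_eq_refl s : tensor_eq s s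
| tensor_eq_sym s t : tensor_eq s t -> tensor_eq t s
| tensor_eq_trans t s u : tensor_eq s t -> tensor_eq t u -> tensor_eq s u
| tensor_eq_cat s s' t t' :
    tensor_eq s s' -> tensor_eq t t' -> tensor_eq (s ++ t) (s' ++ t')
| tensor_eq_comm s t : tensor_eq (s ++ t) (t ++ s)
| tensor_eq_0 m : tensor_eq [:: (0, m)] [::]
| tensor_eq_Dl b b' m :
    tensor_eq [:: (b + b', m)] [:: (b, m); (b', m)]
| tensor_eq_Dr b m m' :
    tensor_eq [:: (b, m + m')] [:: (b, m); (b, m')]
| tensor_eq_bal b a m :
    tensor_eq [:: (b * phi a, m)] [:: (b, a *: m)].

Definition tensor_eqb : rel (seq (B * M)) := fun s t => `[< tensor_eq s t >].

Lemma tensor_eqb_refl : reflexive tensor_eqb.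
Proof. by move=> s; apply/asboolP; apply: tensor_eq_refl. Qed.

Lemma tensor_eqb_sym : symmetric tensor_eqb.
Proof. by move=> s t; apply/asboolP/asboolP => /tensor_eq_sym. Qed.

Lemma tensor_eqb_trans : transitive tensor_eqb.
Proof.
by move=> t s u /asboolP st /asboolP tu; apply/asboolP/(tensor_eq_trans st tu).
Qed.

Canonical tensor_equiv :=
  EquivRel tensor_eqb tensor_eqb_refl tensor_eqb_sym tensor_eqb_trans.

Definition tensor : Type := {eq_quot tensor_equiv}.

HB.instance Definition _ := Choice.on tensor.
HB.instance Definition _ := Quotient.on tensor.

Lemma tensorP s t : (\pi_tensor s = \pi_tensor t) <-> tensor_eq s t.
Proof.
split=> [/eqmodP /asboolP //|st]; by apply/eqmodP/asboolP.
Qed.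

Lemma tensorW (Q : tensor -> Prop) :
  (forall s, Q (\pi_tensor s)) -> forall x, Q x.
Proof. exact: quotW. Qed.

Lemma tensor_repr s : tensor_eq (repr (\pi_tensor s)) s.
Proof. by apply/tensorP; rewrite reprK. Qed.

Definition tensor_mul (b : B) (s : seq (B * M)) : seq (B * M) :=
  [seq (b * p.1, p.2) | p <- s].

Lemma tensor_eq_mul b s t :
  tensor_eq s t -> tensor_eq (tensor_mul b s) (tensor_mul b t).
Proof.
elim=> {s t}.
- by move=> s; apply: tensor_eq_refl.
- by move=> s t _; apply: tensor_eq_sym.
- by move=> t s u _ st _ tu; apply: tensor_eq_trans st tu.
- by move=> s s' t t' _ es _ et; rewrite /tensor_mul !map_cat;
    apply: tensor_eq_cat.
- by move=> s t; rewrite /tensor_mul !map_cat; apply: tensor_eq_comm.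
- by move=> m; rewrite /= mulr0; apply: tensor_eq_0.
- by move=> c c' m; rewrite /= mulrDr; apply: tensor_eq_Dl.
- by move=> c m m' /=; apply: tensor_eq_Dr.
- by move=> c a m /=; rewrite mulrA; apply: tensor_eq_bal.
Qed.

Definition tensor_zero : tensor := \pi_tensor [::].
Definition tensor_add (x y : tensor) : tensor := \pi_tensor (repr x ++ repr y).
Definition tensor_scale (b : B) (x : tensor) : tensor :=
  \pi_tensor (tensor_mul b (repr x)).
Definition tensor_opp (x : tensor) : tensor := tensor_scale (- 1) x.

Lemma tensor_addE s t :
  tensor_add (\pi_tensor s) (\pi_tensor t) = \pi_tensor (s ++ t).
Proof. by apply/tensorP/tensor_eq_cat; apply: tensor_repr. Qed.

Lemma tensor_scaleE b s :
  tensor_scale b (\pi_tensor s) = \pi_tensor (tensor_mul b s).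
Proof. by apply/tensorP/tensor_eq_mul/tensor_repr. Qed.

Lemma tensor_addA : associative tensor_add.
Proof.
by elim/tensorW=> s; elim/tensorW=> t; elim/tensorW=> u; rewrite !tensor_addE catA.
Qed.

Lemma tensor_addC : commutative tensor_add.
Proof.
elim/tensorW=> s; elim/tensorW=> t; rewrite !tensor_addE.
by apply/tensorP/tensor_eq_comm.
Qed.

Lemma tensor_add0 : left_id tensor_zero tensor_add.
Proof. by elim/tensorW=> s; rewrite /tensor_zero tensor_addE. Qed.

Lemma tensor_mulDl b c s :
  tensor_eq (tensor_mul b s ++ tensor_mul c s) (tensor_mul (b + c) s).
Proof.
elim: s => [|[d m] s IH]; first exact: tensor_eq_refl.
rewrite /= -[_ :: tensor_mul (b + c) s]cat1s.
apply: (tensor_eq_trans (t := [:: (b * d, m); (c * d, m)]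
  ++ (tensor_mul b s ++ tensor_mul c s))).
  rewrite -[_ :: (_ ++ _)]cat1s -[[:: _; _]]cat1s -catA.
  apply: tensor_eq_cat; first exact: tensor_eq_refl.
  rewrite -[_ :: tensor_mul c s]cat1s !catA.
  apply: tensor_eq_cat; [exact: tensor_eq_comm|exact: tensor_eq_refl].
apply: tensor_eq_cat IH; rewrite mulrDl.
by apply: tensor_eq_sym; apply: tensor_eq_Dl.
Qed.

Lemma tensor_mul0 s : tensor_eq (tensor_mul 0 s) [::].
Proof.
elim: s => [|[d m] s IH]; first exact: tensor_eq_refl.
rewrite /= mul0r -cat1s -[[::]]cat0s.
by apply: tensor_eq_cat IH; apply: tensor_eq_0.
Qed.

Lemma tensor_mul1 s : tensor_mul 1 s = s.
Proof. by elim: s => //= -[b m] s; rewrite mul1r => ->. Qed.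

Lemma tensor_addN : left_inverse tensor_zero tensor_opp tensor_add.
Proof.
elim/tensorW=> s; rewrite /tensor_opp tensor_scaleE tensor_addE.
apply/tensorP; rewrite -{2}[s]tensor_mul1.
by apply: tensor_eq_trans (tensor_mulDl _ _ _) _; rewrite addNr; apply: tensor_mul0.
Qed.

HB.instance Definition _ := GRing.isZmodule.Build tensor
  tensor_addA tensor_addC tensor_add0 tensor_addN.

Lemma tensor_scaleA b c x :
  tensor_scale b (tensor_scale c x) = tensor_scale (b * c) x.
Proof.
elim/tensorW: x => s; rewrite !tensor_scaleE; congr \pi.
by rewrite /tensor_mul -map_comp; apply: eq_map => -[d m] /=; rewrite mulrA.
Qed.

Lemma tensor_scale1 : left_id 1 tensor_scale.
Proof. by elim/tensorW=> s; rewrite tensor_scaleE tensor_mul1. Qed.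

Lemma tensor_scaleDr : right_distributive tensor_scale +%R.
Proof.
move=> b; elim/tensorW=> s; elim/tensorW=> t.
by rewrite /GRing.add /= !(tensor_addE, tensor_scaleE) /tensor_mul map_cat.
Qed.

Lemma tensor_scaleDl x : {morph tensor_scale^~ x : b c / b + c}.
Proof.
move=> b c; elim/tensorW: x => s; rewrite !tensor_scaleE {2}/GRing.add /=.
rewrite tensor_addE; apply/tensorP/tensor_eq_sym/tensor_mulDl.
Qed.

HB.instance Definition _ := GRing.Zmodule_isLmodule.Build B tensor
  tensor_scaleA tensor_scale1 tensor_scaleDr tensor_scaleDl.

Definition pure (b : B) (m : M) : tensor := \pi_tensor [:: (b, m)].

Lemma pureDl m : {morph pure^~ m : b c / b + c}.
Proof.
move=> b c; rewrite {2}/GRing.add /= tensor_addE.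
by apply/tensorP/tensor_eq_Dl.
Qed.

Lemma pureDr b : {morph pure b : m n / m + n}.
Proof.
move=> m n; rewrite {2}/GRing.add /= tensor_addE.
by apply/tensorP/tensor_eq_Dr.
Qed.

Lemma pure_bal b a m : pure (b * phi a) m = pure b (a *: m).
Proof. by apply/tensorP/tensor_eq_bal. Qed.

Lemma pure_scale b c m : b *: pure c m = pure (b * c) m.
Proof. by rewrite {1}/GRing.scale /= tensor_scaleE. Qed.

Lemma pi_tensor_sum s : \pi_tensor s = \sum_(p <- s) pure p.1 p.2.
Proof.
elim: s => [|[b m] s IH]; first by rewrite big_nil.
by rewrite big_cons -IH /GRing.add /= tensor_addE.
Qed.

Lemma tensor_fg : finitely_generated M -> finitely_generated tensor.
Proof.
case=> n [g gP]; exists n, (fun i => pure 1 (g i)); elim/tensorW=> s.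
rewrite pi_tensor_sum.
elim: s => [|[b m] s [c IH]].
  exists (fun=> 0); rewrite big_nil big1 // => i _; exact: scale0r.
have [a ->] := gP m; exists (fun i => b * phi (a i) + c i).
rewrite big_cons IH (big_morph _ (pureDr b) (id1 := 0)) /=; last first.
  by apply/eqP; rewrite -(inj_eq (addrI (pure b 0))) -pureDr !addr0.
rewrite -big_split /=; apply: eq_bigr => i _.
by rewrite scalerDl -pure_bal; congr (_ + _); rewrite pure_scale mulr1.
Qed.
End Tensor.

Section TensorMap.
Variables (M N : lmodType A) (f : {linear M -> N}).

Lemma tensor_eq_map (s t : seq (B * M)) : tensor_eq s t ->
  tensor_eq [seq (p.1, f p.2) | p <- s] [seq (p.1, f p.2) | p <- t].
Proof.
elim=> {s t} /=.
- by move=> s; apply: tensor_eq_refl.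
- by move=> s t _; apply: tensor_eq_sym.
- by move=> t s u _ st _ tu; apply: tensor_eq_trans st tu.
- by move=> s s' t t' _ es _ et; rewrite !map_cat; apply: tensor_eq_cat.
- by move=> s t; rewrite !map_cat; apply: tensor_eq_comm.
- by move=> m; apply: tensor_eq_0.
- by move=> b b' m; apply: tensor_eq_Dl.
- by move=> b m m'; rewrite linearD; apply: tensor_eq_Dr.
- by move=> b a m; rewrite linearZ; apply: tensor_eq_bal.
Qed.

Definition tensor_map (x : tensor M) : tensor N :=
  \pi_(tensor N) [seq (p.1, f p.2) | p <- repr x].

Lemma tensor_mapE s :
  tensor_map (\pi_(tensor M) s) = \pi_(tensor N) [seq (p.1, f p.2) | p <- s].
Proof. exact/tensorP/tensor_eq_map/tensor_repr. Qed.

Lemma tensor_map_linear : linear tensor_map.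
Proof.
move=> b; elim/tensorW=> s; elim/tensorW=> t; rewrite /GRing.add /GRing.scale /=.
rewrite !(tensor_mapE, tensor_scaleE, tensor_addE) map_cat.
by rewrite /tensor_mul -!map_comp.
Qed.

HB.instance Definition _ :=
  GRing.isLinear.Build B (tensor M) (tensor N) *:%R tensor_map
    tensor_map_linear.
End TensorMap.

Definition tensor_functor : functor (fgmod_cat A) (fgmod_cat B).
Proof.
refine (@Functor (fgmod_cat A) (fgmod_cat B)
  (fun M : fgmod A => FgMod (tensor_fg (fgmodP M)))
  (fun (M N : fgmod A) (f : {linear M -> N}) => tensor_map f) _ _).
- move=> M; apply: linear_eq; elim/tensorW=> s /=; rewrite tensor_mapE.
  by congr \pi; elim: s => //= -[b m] s ->.
- move=> M N P f g; apply: linear_eq; elim/tensorW=> s /=.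
  by rewrite !tensor_mapE -map_comp.
Defined.

Definition split_extension : Prop := separable_functor tensor_functor.

Definition projective (R : pzRingType) (P : lmodType R) : Prop :=
  forall (M N : lmodType R) (g : {linear M -> N}) (f : {linear P -> N}),
    (forall y, exists x, g x = y) ->
    exists h : {linear P -> M}, forall x, g (h x) = f x.

End Scalars.

Arguments projective {R} P.

(** * Finite dimensional algebras *)

Section Algebras.
Variables (k : fieldType) (A B : falgType k) (phi : {lrmorphism A -> B}).

Lemma restrict_fg (M : lmodType B) :
  finitely_generated M -> finitely_generated (restrict phi M).
Proof.
case=> n [g gP]; set b := vbasis {:B}.
pose e := fun p : 'I_n * 'I_(\dim {:B}) => (b`_p.2 *: g p.1 : restrict phi M).
exists #|{: 'I_n * 'I_(\dim {:B})}|, (fun i => e (enum_val i)) => x.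
have [c ->] := gP x.
exists (fun i => (coord b (enum_val i).2 (c (enum_val i).1))%:A).
rewrite -(big_enum_val (fun p => (coord b p.2 (c p.1))%:A *: e p)) /=.
rewrite -(pair_big predT predT (fun i j => (coord b j (c i))%:A *: e (i, j))) /=.
apply: eq_bigr => i _.
rewrite {1}(coord_vbasis (memvf (c i))) scaler_suml; apply: eq_bigr => j _.
rewrite (restrict_scaleE phi (_%:A) (b`_j *: g i)) scalerA.
by apply: (congr1 (fun y : B => y *: g i)); rewrite /= linearZ rmorph1 /= mulr_algl.
Qed.

Definition restrict_functor : functor (fgmod_cat B) (fgmod_cat A).
Proof.
refine (@Functor (fgmod_cat B) (fgmod_cat A)
  (fun M : fgmod B => FgMod (restrict_fg (fgmodP M)))
  (fun (M N : fgmod B) (f : {linear M -> N}) => @restrict_map _ _ phi M N f) _ _).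
- by move=> M; apply: linear_eq.
- by move=> M N P f g; apply: linear_eq.
Defined.

Definition separable_extension : Prop := separable_functor restrict_functor.
End Algebras.

(** * The bounded derived category of finitely generated modules *)

(* The differential is a family indexed by all pairs of degrees, zero unless
   j = i + 1; this avoids casts between X (i - 1 + 1) and X i. *)
Record bcomplex (A : pzRingType) := BComplex {
  cobj :> int -> fgmod A;
  diff : forall i j : int, {linear cobj i -> cobj j};
  diff_shape : forall i j, j != i + 1 -> forall x, diff i j x = 0;
  diffK : forall i j l (x : cobj i), diff j l (diff i j x) = 0;
  cbounded : exists n : nat, forall i : int,
    n%:Z < `|i| -> forall x : cobj i, x = 0 }.

Arguments diff {A} X i j : rename.

Section Complexes.
Variable A : pzRingType.
Implicit Types X Y Z : bcomplex A.

Definition cocycle X (i : int) (x : X i) : Prop := diff X i (i + 1) x = 0.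

Definition coboundary X (i : int) (x : X i) : Prop :=
  exists y : X (i - 1), x = diff X (i - 1) i y.

Record chain_map X Y := ChainMap {
  cmap :> forall i : int, {linear X i -> Y i};
  cmap_diff : forall i j x, cmap j (diff X i j x) = diff Y i j (cmap i x) }.

Definition chain_id X : chain_map X X :=
  @ChainMap X X (fun i => idfun) (fun _ _ _ => erefl).

Definition chain_comp X Y Z (g : chain_map Y Z) (f : chain_map X Y) :
  chain_map X Z.
Proof.
refine (@ChainMap X Z (fun i => g i \o f i) _) => i j x /=.
by rewrite !cmap_diff.
Defined.

Definition homotopic X Y (f g : chain_map X Y) : Prop :=
  exists h : forall i j : int, {linear X i -> Y j}, forall i (x : X i),
    f i x - g i x =
    diff Y (i - 1) i (h i (i - 1) x) + h (i + 1) i (diff X i (i + 1) x).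

(* H^i(f) is injective and surjective for every i, where
   H^i(X) = cocycles / coboundaries. *)
Definition quasi_iso X Y (f : chain_map X Y) : Prop :=
  forall i : int,
    (forall x : X i, cocycle x -> coboundary (f i x) -> coboundary x) /\
    (forall y : Y i, cocycle y ->
       exists x : X i, cocycle x /\ coboundary (y - f i x)).

(* The bounded derived category is the localisation of the bounded homotopy
   category at the quasi-isomorphisms: its morphisms are the formal composites
   of chain maps and inverses of quasi-isomorphisms, modulo [der_eq]. *)
Inductive der_hom : bcomplex A -> bcomplex A -> Type :=
| der_map X Y : chain_map X Y -> der_hom X Y
| der_inv X Y (s : chain_map X Y) : quasi_iso s -> der_hom Y X
| der_comp X Y Z : der_hom Y Z -> der_hom X Y -> der_hom X Z.

Definition der_id X : der_hom X X := der_map (chain_id X).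

Inductive der_eq : forall X Y, der_hom X Y -> der_hom X Y -> Prop :=
| der_eq_refl X Y (u : der_hom X Y) : der_eq u u
| der_eq_sym X Y (u v : der_hom X Y) : der_eq u v -> der_eq v u
| der_eq_trans X Y (u v w : der_hom X Y) :
    der_eq u v -> der_eq v w -> der_eq u w
| der_eq_comp X Y Z (v v' : der_hom Y Z) (u u' : der_hom X Y) :
    der_eq v v' -> der_eq u u' -> der_eq (der_comp v u) (der_comp v' u')
| der_eq_assoc X Y Z W (u : der_hom X Y) (v : der_hom Y Z) (w : der_hom Z W) :
    der_eq (der_comp w (der_comp v u)) (der_comp (der_comp w v) u)
| der_eq_1l X Y (u : der_hom X Y) : der_eq (der_comp (der_id Y) u) u
| der_eq_1r X Y (u : der_hom X Y) : der_eq (der_comp u (der_id X)) u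
| der_eq_map_comp X Y Z (g : chain_map Y Z) (f : chain_map X Y) :
    der_eq (der_map (chain_comp g f)) (der_comp (der_map g) (der_map f))
| der_eq_homotopic X Y (f g : chain_map X Y) :
    homotopic f g -> der_eq (der_map f) (der_map g)
| der_eq_invl X Y (s : chain_map X Y) (qs : quasi_iso s) :
    der_eq (der_comp (der_inv qs) (der_map s)) (der_id X)
| der_eq_invr X Y (s : chain_map X Y) (qs : quasi_iso s) :
    der_eq (der_comp (der_map s) (der_inv qs)) (der_id Y).

Definition der_isomorphic X Y : Prop :=
  exists (u : der_hom X Y) (v : der_hom Y X),
    der_eq (der_comp v u) (der_id X) /\ der_eq (der_comp u v) (der_id Y).

Definition iso_class X : bcomplex A -> Prop := fun Y => der_isomorphic X Y.
End Complexes.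

Section DerivedDiscrete.
Variables (k : fieldType) (A : falgType k).

(* dim_k H^i(X) = n: some n cocycles form a k-basis of the cocycles modulo the
   coboundaries; k acts on A-modules through c |-> c%:A. *)
Definition cohomology_dim (X : bcomplex A) (i : int) (n : nat) : Prop :=
  exists z : 'I_n -> X i, (forall s, cocycle (z s)) /\
    forall x : X i, cocycle x -> exists! c : {ffun 'I_n -> k},
      coboundary (x - \sum_(s < n) (c s)%:A *: z s).

(* The classes of the complexes with dimension vector n all occur in a finite
   list C. For universe reasons [bcomplex A] cannot be an argument of
   [classical_sets.set], so [finite_set] is not available here. *)
Definition derived_discrete : Prop :=
  forall n : int -> nat, finite_set [set i | n i != 0%N]%classic ->
    exists (m : nat) (C : 'I_m -> (bcomplex A -> Prop)),
      forall X : bcomplex A, (forall i, cohomology_dim X i (n i)) ->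
        exists s, iso_class X = C s.
End DerivedDiscrete.

(* Main.v *)
From HB Require Import structures.
Require Import Defs.
From mathcomp Require Import all_boot all_order all_algebra all_field.
From mathcomp Require Import boolp classical_sets functions cardinality.
From mathcomp Require Import ring zify.

(* In both parts a complex X is a natural direct summand of the complex obtained
   by applying the two functors one after the other (Rafael), so it is enough to
   bound the number of classes of the latter and to know that an object Z of the
   bounded derived category has only finitely many direct summands up to
   isomorphism.

   Summands: a morphism that acts bijectively on cohomology is invertible, so
   summands of Z are classified by the corresponding idempotents of the image of
   End(Z) in the endomorphisms of the finite dimensional total cohomology of Z,
   and a finite dimensional algebra has finitely many classes of idempotents.

   Part (2): restriction preserves dimension vectors, and B (x)_A - is exact
   since B_A is projective.  Part (1): B (x)_A - need not be exact, but a complex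
   with a given dimension vector is isomorphic in the derived category to one
   whose terms have bounded dimension; for such complexes B (x)_A - is applied
   termwise, and only finitely many dimension vectors can occur. *)

Set Implicit Arguments.
Unset Strict Implicit.
Unset Printing Implicit Defensive.

Import GRing.Theory Num.Theory.
Local Open Scope ring_scope.

(** * Finiteness up to a relation *)

Definition finitely_many (T : Type) (P : T -> Prop) (E : T -> T -> Prop) : Prop :=
  exists (I : finType) (c : T -> I),
    forall x y, P x -> P y -> c x = c y -> E x y.

Lemma finitely_many_map (T T' : Type) (f : T -> T') (P : T -> Prop)
    (P' : T' -> Prop) (E : T -> T -> Prop) (E' : T' -> T' -> Prop) :
  (forall x, P x -> P' (f x)) ->
  (forall x y, P x -> P y -> E' (f x) (f y) -> E x y) ->
  finitely_many P' E' -> finitely_many P E.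
Proof.
move=> fP fE [I [c cP]]; exists I, (c \o f) => x y Px Py cxy.
by apply: fE => //; apply: cP => //; apply: fP.
Qed.

Lemma finitely_many_union (T : Type) (J : finType) (P : T -> Prop)
    (Q : J -> T -> Prop) (E : T -> T -> Prop) :
  (forall x, P x -> exists j, Q j x) ->
  (forall j, finitely_many (Q j) E) -> finitely_many P E.
Proof.
move=> PQ fQ; pose I j := projT1 (cid (fQ j)).
have [c cP] : exists c : forall j, T -> I j,
    forall j x y, Q j x -> Q j y -> c j x = c j y -> E x y.
  pose cI j := cid (projT2 (cid (fQ j))).
  by exists (fun j => projT1 (cI j)) => j; exact: projT2 (cI j).
have [j jP] : {j : T -> option J &
    forall x, P x -> exists2 i, j x = Some i & Q i x}.
  apply: (@choice _ _ (fun x o => P x -> exists2 i, o = Some i & Q i x)) => x.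
  have [/PQ[i Qi]|nP] := pselect (P x); last by exists None.
  by exists (Some i) => _; exists i.
exists (option {i : J & I i}).
exists (fun x => omap (fun i => Tagged I (c i x)) (j x)).
move=> x y /jP[i ji Qx] /jP[i' ji' Qy].
rewrite ji ji' /= => /Some_inj e.
have ii' : i = i' by exact: (congr1 tag e).
by subst i'; apply: (cP i) => //; exact: eq_from_Tagged e.
Qed.

Lemma finitely_many_fiber (T : Type) (P : T -> Prop) (E E' : T -> T -> Prop) :
  finitely_many P E' ->
  (forall y, P y -> finitely_many (fun x => P x /\ E' y x) E) ->
  finitely_many P E.
Proof.
move=> [I [c cP]] fE.
apply: (finitely_many_union (Q := fun i x => P x /\ c x = i)).
  by move=> x Px; exists (c x).
move=> i; have [[y [Py cy]]|n] := pselect (exists y, P y /\ c y = i); last first.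
  by exists I, c => x y ? ? ?; case: n; exists x.
apply: (finitely_many_map (f := id) _ _ (fE y Py)) => // x [Px cx]; split=> //.
by apply: cP => //; rewrite cy cx.
Qed.

(** * Idempotents of a finite dimensional algebra *)

Section Idempotents.
Variables (k : fieldType) (N : nat) (S : 'M[k]_N.+1 -> Prop).
Hypotheses (S1 : S 1) (SD : forall x y, S x -> S y -> S (x + y)).
Hypotheses (SM : forall x y, S x -> S y -> S (x * y)).
Hypothesis SZ : forall c x, S x -> S (c *: x).

Let S0 : S 0. Proof. by rewrite -(scale0r 1); exact: SZ. Qed.

Let SB x y : S x -> S y -> S (x - y).
Proof. by move=> Sx Sy; apply: SD => //; rewrite -scaleN1r; apply: SZ. Qed.

Let SX x n : S x -> S (x ^+ n).
Proof. by move=> Sx; elim: n => // n IH; rewrite exprS; apply: SM. Qed.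

Let Ssum (I : Type) (r : seq I) F : (forall i, S (F i)) -> S (\sum_(i <- r) F i).
Proof. by move=> SF; apply: big_ind. Qed.

Let Shorner x p : S x -> S (horner_mx x p).
Proof.
move=> Sx; rewrite -[p]coefK poly_def linear_sum; apply: Ssum => i.
by rewrite linearZ /= rmorphXn /= horner_mx_X; apply/SZ/SX.
Qed.

Definition corner (e x : 'M[k]_N.+1) := [/\ S x, e * x = x & x * e = x].

Definition idem (e : 'M[k]_N.+1) := S e /\ e * e = e.

Lemma corner_sum e (s : seq 'M[k]_N.+1) :
  (forall x, x \in s -> corner e x) -> corner e (\sum_(x <- s) x).
Proof.
move=> sP; rewrite big_seq; apply: big_ind => // [|x y [Sx ex xe] [Sy ey ye]].
  by split; rewrite ?mulr0 ?mul0r.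
by split; [apply: SD|rewrite mulrDr ex ey|rewrite mulrDl xe ye].
Qed.

Lemma fitting e x : idem e -> corner e x -> exists y,
  [/\ corner e y, x * y = y * x, idem (x * y) &
      x * y = 0 -> exists m, x ^+ m = 0].
Proof.
move=> [Se ee] [Sx ex xe].
have [m [q q0 pE]] := multiplicity_XsubC (char_poly x) 0.
have {}q0 : coprimep 'X^(m.+2) q.
  apply: coprimep_expl; rewrite coprimep_sym coprimepX.
  by apply: implyP q0 _; apply/monic_neq0/char_poly_monic.
have [[a b] /= ab] := Bezout_eq1_coprimepP _ _ q0.
pose P : {rmorphism {poly k} -> 'M[k]_N.+1} := horner_mx x.
have PX : P 'X = x by exact: horner_mx_X.
have Pq : P ('X^m * q) = 0.
  by have := Cayley_Hamilton x; rewrite pE subr0 mulrC.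
have xy : x * P (a * 'X^(m.+1)) = P (a * 'X^(m.+2)).
  by rewrite -{1}PX -rmorphM /=; congr (P _); rewrite mulrCA -exprS.
exists (P (a * 'X^(m.+1))); rewrite xy; split.
- split; first exact: Shorner.
    have -> : a * 'X^(m.+1) = 'X * (a * 'X^m) by rewrite mulrCA -exprS.
    by rewrite rmorphM /= PX mulrA ex.
  by rewrite exprSr mulrA rmorphM /= PX -mulrA xe.
- by rewrite -xy -{1}PX -rmorphM mulrC rmorphM /= PX.
- split; first exact: Shorner.
  have E : a * 'X^(m.+2) * (a * 'X^(m.+2))
      = a * 'X^(m.+2) - a * b * 'X^2 * ('X^m * q).
    have {1}-> : a * 'X^(m.+2) = 1 - b * q by rewrite -ab addrK.
    by rewrite (exprD 'X 2 m : 'X^(m.+2) = _); ring.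
  by rewrite -rmorphM E rmorphB [P (_ * ('X^m * q))]rmorphM Pq mulr0 subr0.
- move=> axm; exists m; rewrite -PX -rmorphXn -['X^m]mulr1 -ab mulrDr.
  rewrite (_ : 'X^m * (b * q) = b * ('X^m * q)); last by ring.
  by rewrite rmorphD [P ('X^m * _)]rmorphM axm mulr0 add0r rmorphM Pq mulr0.
Qed.

Definition corner_unit (e x : 'M[k]_N.+1) :=
  exists y, [/\ corner e y, x * y = e & y * x = e].

Lemma corner_nilpotent_unit e z m :
  idem e -> corner e z -> z ^+ m = 0 -> corner_unit e (e - z).
Proof.
move=> [Se ee] [Sz ez ze] zm.
pose g := \sum_(i < m) z ^+ i.
have zg : (1 - z) * g = 1.
  by apply: oppr_inj; rewrite -mulNr opprB -subrX1 zm sub0r.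
have gz : g * (1 - z) = 1.
  rewrite -[RHS]zg mulrBr mulrBl mulr1 mul1r; congr (_ - _).
  rewrite mulr_suml mulr_sumr; apply: eq_bigr => i _.
  by rewrite -exprS -exprSr.
have ge : g * e = e * g.
  rewrite mulr_suml mulr_sumr; apply: eq_bigr => -[i _] /= _.
  elim: i => [|i IH]; first by rewrite mulr1 mul1r.
  by rewrite exprS -mulrA IH !mulrA ez ze.
have eE : e - z = e * (1 - z) by rewrite mulrBr mulr1 ez.
have eE' : e - z = (1 - z) * e by rewrite mulrBl mul1r ze.
exists (e * g); split.
- split; first by apply: SM => //; apply: Ssum => i; apply: SX.
    by rewrite mulrA ee.
  by rewrite -mulrA ge mulrA ee.
- by rewrite eE' mulrA -[_ * e * e]mulrA ee -mulrA -ge mulrA zg mul1r.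
- by rewrite eE mulrA -[e * g * e]mulrA ge !mulrA ee -mulrA gz mulr1.
Qed.

Definition primitive e := [/\ idem e, e <> 0 &
  forall g, idem g -> e * g = g -> g * e = g -> g = 0 \/ g = e].

(* The corner algebra of a primitive idempotent is local. *)
Lemma primitive_sum_unit e (s : seq 'M[k]_N.+1) :
  primitive e -> (forall x, x \in s -> corner e x) ->
  corner_unit e (\sum_(x <- s) x) -> exists2 x, x \in s & corner_unit e x.
Proof.
move=> [ie e0 ep]; have [Se ee] := ie.
have unit0 : ~ corner_unit e 0.
  by move=> [y [_ ye _]]; apply: e0; rewrite -ye mul0r.
elim: s => [|x s IH] sP; first by rewrite big_nil.
have {}IH := IH (fun x xs => sP x (mem_behead (s := _ :: _) xs)).
have cx : corner e x by apply: sP; rewrite mem_head.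
rewrite big_cons; set t := \sum_(_ <- _) _ in IH * => -[w [[Sw ew we] tw wt]].
have [Sx ex xe] := cx.
have ct : corner e t.
  by apply: corner_sum => y ys; apply: sP; rewrite inE ys orbT.
have [St et te] := ct.
have cwx : corner e (w * x).
  by split; [apply: SM|rewrite mulrA ew|rewrite -mulrA xe].
have [y [[Sy ey ye] xy ixy xy0]] := fitting ie cwx.
have [| |/xy0[m wxm]|wxy] := ep _ ixy.
- by rewrite !mulrA ew.
- by rewrite -!mulrA ye.
- have [z [[Sz ez ze] zw wz]] := corner_nilpotent_unit ie cwx wxm.
  have wtE : w * t = e - w * x by rewrite -wt mulrDr addrAC subrr add0r.
  have [|z' z's uz'] := IH; last by exists z' => //; rewrite inE z's orbT.
  exists (z * w); split.
  + by split; [apply: SM|rewrite mulrA ez|rewrite -mulrA we].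
  + have -> : t = (x + t) * (e - w * x).
      by rewrite -wtE mulrA tw et.
    by rewrite -mulrA [_ * (z * w)]mulrA zw ew tw.
  + by rewrite -mulrA wtE wz.
- exists x; first by rewrite mem_head.
  exists (y * w); split.
  + by split; [apply: SM|rewrite mulrA ey|rewrite -mulrA we].
  + have {1}-> : x = (x + t) * (w * x) by rewrite mulrA tw ex.
    by rewrite -mulrA [_ * (y * w)]mulrA wxy ew tw.
  + by rewrite -mulrA -xy.
Qed.

Definition idem_equiv e f := exists u v, [/\ S u, S v, u * v = e & v * u = f].

Lemma idem_equivP e f : idem e -> idem f -> idem_equiv e f ->
  exists u v, [/\ S u, S v, u * v = e & v * u = f] /\
    [/\ e * u = u, u * f = u, f * v = v & v * e = v].
Proof.
move=> [Se ee] [Sf ff] [u [v [Su Sv uv vu]]].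
exists (e * u * f), (f * v * e); split; split; do ?by do !apply: SM.
- rewrite (_ : _ * _ = e * (u * (f * f) * v) * e); last by rewrite !mulrA.
  rewrite ff -vu (_ : u * _ * v = (u * v) * (u * v)); last by rewrite !mulrA.
  by rewrite uv !ee.
- rewrite (_ : _ * _ = f * (v * (e * e) * u) * f); last by rewrite !mulrA.
  rewrite ee -uv (_ : v * _ * u = (v * u) * (v * u)); last by rewrite !mulrA.
  by rewrite vu !ff.
- by rewrite !mulrA ee.
- by rewrite -!mulrA ff.
- by rewrite !mulrA ff.
- by rewrite -!mulrA ee.
Qed.

Lemma idem_equiv_sym e f : idem_equiv e f -> idem_equiv f e.
Proof. by move=> [u [v [? ? ? ?]]]; exists v, u. Qed.

Lemma idem_equiv_trans e f g : idem e -> idem f -> idem g ->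
  idem_equiv e f -> idem_equiv f g -> idem_equiv e g.
Proof.
move=> [Se ee] [Sf ff] [Sg gg] [u [v [Su Sv uv vu]]] [u' [v' [Su' Sv' uv' vu']]].
exists (u * u'), (v' * v); split; do ?exact: SM.
- rewrite -mulrA [u' * _]mulrA uv' -vu.
  by rewrite (_ : u * _ = (u * v) * (u * v)); [rewrite uv ee|rewrite !mulrA].
- rewrite -mulrA [v * _]mulrA vu -uv'.
  by rewrite (_ : v' * _ = (v' * u') * (v' * u')); [rewrite vu' gg|rewrite !mulrA].
Qed.

Lemma primitive_equiv_summand e (s : seq 'M[k]_N.+1) :
  primitive e -> (forall f, f \in s -> primitive f) -> \sum_(f <- s) f = 1 ->
  exists2 f, f \in s & idem_equiv e f.
Proof.
move=> pe sP s1; have [[Se ee] e0 _] := pe.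
have eE : \sum_(x <- [seq e * f * e | f <- s]) x = e.
  by rewrite big_map -mulr_suml -mulr_sumr s1 mulr1.
have [| |_ /mapP[f fs ->] [y [[Sy ey ye] xy yx]]] :=
  primitive_sum_unit (s := [seq e * f * e | f <- s]) pe.
- move=> _ /mapP[f /sP[[Sf _] _ _] ->]; split.
  + by do !apply: SM.
  + by rewrite !mulrA ee.
  + by rewrite -!mulrA ee.
- by rewrite eE; exists e.
have [[Sf ff] _ fp] := sP f fs.
have uv : (e * f) * (f * e * y) = e by rewrite !mulrA -(mulrA e) ff xy.
exists f => //; exists (e * f), (f * e * y); split=> //; do ?by do !apply: SM.
have ig : idem (f * e * y * (e * f)).
  split; first by do !apply: SM.
  rewrite mulrA -[_ * (e * f) * (f * e * y)]mulrA uv.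
  by rewrite -[_ * _ * _ * e]mulrA ye.
have [| |g0|//] := fp _ ig.
- by rewrite !mulrA ff.
- by rewrite -!mulrA ff.
case: e0; rewrite -[LHS]ee -[in LHS]uv.
have -> (a b : 'M[k]_N.+1) : a * b * (a * b) = a * (b * a) * b by rewrite !mulrA.
by rewrite g0 mulr0 mul0r.
Qed.

Lemma idem_sub e g : idem e -> idem g -> e * g = g -> g * e = g -> idem (e - g).
Proof.
move=> [Se ee] [Sg gg] eg ge; split; first exact: SB.
by rewrite mulrBr !mulrBl ee eg ge gg subrr subr0.
Qed.

Lemma idem_rank_lt e g : idem e -> idem g -> e * g = g -> g * e = g -> g <> e ->
  (\rank g < \rank e)%N.
Proof.
move=> ie ig eg ge gne; have le : (g <= e)%MS by rewrite -ge; apply: submxMl.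
have := mxrank_leqif_eq le; rewrite /leqif => -[re re']; rewrite ltn_neqAle re andbT re'.
apply/negP => /andP[_ /submxP[w ew]]; apply: gne.
by rewrite -eg {1}ew -[_ *m _]/(w * g) -mulrA (proj2 ig) -[LHS]/(w *m g) -ew.
Qed.

Lemma exists_primitive e : idem e -> e <> 0 ->
  exists2 g, primitive g & e * g = g /\ g * e = g.
Proof.
have [n] := ubnP (\rank e); elim: n e => // n IH e /ltnSE re ie e0.
have [pe|] := pselect (primitive e); first by exists e; rewrite ?(proj2 ie).
move=> npe; have [g [ig eg ge g0 gne]] :
    exists g, [/\ idem g, e * g = g, g * e = g, g <> 0 & g <> e].
  apply: contrapT => ng; apply: npe; split=> // g ig eg ge.
  have [->|g0] := pselect (g = 0); first by left.
  have [->|gne] := pselect (g = e); first by right.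
  by case: ng; exists g.
have [|h ph [gh hg]] := IH g _ ig g0.
  exact: leq_trans (idem_rank_lt ie ig eg ge gne) re.
by exists h => //; split; [rewrite -gh mulrA eg|rewrite -hg -mulrA ge].
Qed.

Lemma primitive_decomposition e : idem e ->
  exists2 s : seq 'M[k]_N.+1, (forall f, f \in s -> primitive f) &
    \sum_(f <- s) f = e.
Proof.
have [n] := ubnP (\rank e); elim: n e => // n IH e /ltnSE re ie.
have [->|e0] := pselect (e = 0); first by exists [::]; rewrite ?big_nil.
have [g pg [eg ge]] := exists_primitive ie e0.
have [ig g0 _] := pg.
have ieg := idem_sub ie ig eg ge.
have [| |s sP sE] := IH (e - g); last 1 first.
- exists (g :: s); last by rewrite big_cons sE addrC subrK.
  by move=> f; rewrite inE => /orP[/eqP->|/sP].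
- apply: leq_trans re; apply: idem_rank_lt => //.
  + by rewrite mulrBr (proj2 ie) eg.
  + by rewrite mulrBl (proj2 ie) ge.
  + by move=> /eqP; rewrite eq_sym -subr_eq0 opprB addrC subrK => /eqP.
- exact: ieg.
Qed.

Inductive idem_type (d : seq 'M[k]_N.+1) : 'M[k]_N.+1 -> seq nat -> Prop :=
| idem_type_nil : idem_type d 0 [::]
| idem_type_cons e g i l : idem g -> e * g = g -> g * e = g ->
    idem_equiv g d`_i -> idem_type d (e - g) l -> idem_type d e (i :: l).

Lemma idem_typeP d e : (forall f, f \in d -> primitive f) -> \sum_(f <- d) f = 1 ->
  idem e -> exists l, [/\ (size l <= \rank e)%N, all (fun i => i < size d)%N l &
    idem_type d e l].
Proof.
move=> dP d1; have [n] := ubnP (\rank e); elim: n e => // n IH e /ltnSE re ie.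
have [->|e0] := pselect (e = 0); first by exists [::]; split=> //; constructor.
have [g pg [eg ge]] := exists_primitive ie e0.
have [ig g0 _] := pg; have ieg := idem_sub ie ig eg ge.
have [f fd gf] := primitive_equiv_summand pg dP d1.
have rlt : (\rank (e - g)%R < \rank e)%N.
  apply: idem_rank_lt => //.
  + by rewrite mulrBr (proj2 ie) eg.
  + by rewrite mulrBl (proj2 ie) ge.
  + by move=> /eqP; rewrite eq_sym -subr_eq0 opprB addrC subrK => /eqP.
have [|//|l [sl ld tl]] := IH (e - g); first exact: leq_trans re.
exists (index f d :: l); split=> /=; first exact: leq_ltn_trans rlt.
  by rewrite index_mem fd.
by apply: idem_type_cons tl => //; rewrite nth_index.
Qed.

Lemma idem_type_equiv d e e' l : (forall f, f \in d -> idem f) ->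
  all (fun i => i < size d)%N l -> idem e -> idem e' ->
  idem_type d e l -> idem_type d e' l -> idem_equiv e e'.
Proof.
move=> dP; elim: l e e' => [|i l IH] e e' /=.
  move=> _ _ _ te te'; inversion te; inversion te'; exists 0, 0.
  by split=> //; rewrite mulr0.
move=> /andP[id ld] ie ie' te te'; inversion te as [|? g ? ? ig eg ge gi tg]; subst.
inversion te' as [|? g' ? ? ig' eg' ge' gi' tg']; subst.
have ieg := idem_sub ie ig eg ge; have ieg' := idem_sub ie' ig' eg' ge'.
have gg' : idem_equiv g g'.
  by apply: idem_equiv_trans gi (idem_equiv_sym gi') => //; apply/dP/mem_nth.
have [u [v [[Su Sv uv vu] [gu ug gv vg]]]] := idem_equivP ig ig' gg'.
have [u' [v' [[Su' Sv' uv' vu'] [gu' ug' gv' vg']]]] :=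
  idem_equivP ieg ieg' (IH _ _ ld ieg ieg' tg tg').
have ort a b : idem a -> b * a = a -> a * b = a -> a * (b - a) = 0 /\ (b - a) * a = 0.
  by move=> [Sa aa] ba ab; rewrite mulrBr mulrBl ba ab aa subrr.
have [o1 o2] := ort _ _ ig eg ge; have [o1' o2'] := ort _ _ ig' eg' ge'.
exists (u + u'), (v + v'); split; do ?exact: SD.
- have z1 : u' * v = 0 by rewrite -ug' -gv mulrA -(mulrA u') o2' mulr0 mul0r.
  have z2 : u * v' = 0 by rewrite -ug -gv' mulrA -(mulrA u) o1' mulr0 mul0r.
  by rewrite mulrDr !mulrDl uv uv' z1 z2 addr0 add0r addrC subrK.
- have z1 : v' * u = 0 by rewrite -vg' -gu mulrA -(mulrA v') o2 mulr0 mul0r.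
  have z2 : v * u' = 0 by rewrite -vg -gu' mulrA -(mulrA v) o1 mulr0 mul0r.
  by rewrite mulrDr !mulrDl vu vu' z1 z2 addr0 add0r addrC subrK.
Qed.

Lemma finitely_many_idem_pos : finitely_many idem idem_equiv.
Proof.
have [|d dP d1] := @primitive_decomposition 1; first by split; rewrite ?mulr1.
pose J := option (N.+1.-bseq 'I_(size d)).
have [c cP] : {c : 'M[k]_N.+1 -> J & forall e, idem e ->
    exists2 l : N.+1.-bseq 'I_(size d), c e = Some l &
      idem_type d e [seq val i | i <- l]}.
  apply: (@choice _ _ (fun e c => idem e -> exists2 l, c = Some l &
    idem_type d e [seq val i | i <- val l])) => e.
  have [ie|] := pselect (idem e); last by exists None.
  have [l [sl ld tl]] := idem_typeP dP d1 ie.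
  have vl : [seq val i | i <- pmap insub l : seq 'I_(size d)] = l.
    rewrite pmap_filter; last exact: insubK.
    by apply/all_filterP; apply: sub_all ld => i li; rewrite /= isSome_insub.
  have sb : (size (pmap insub l : seq 'I_(size d)) <= N.+1)%N.
    by rewrite -(size_map val) vl; apply: leq_trans sl (rank_leq_row e).
  by exists (Some (Bseq sb)) => _; exists (Bseq sb); rewrite //= vl.
exists J, c => e f ie jf; have [l -> te] := cP e ie; have [l' -> tf] := cP f jf.
move=> [ll']; rewrite -{}ll' in tf; apply: (idem_type_equiv (d := d)) te tf => //.
  by move=> g /dP[].
by apply/allP => i /mapP[j _ ->]; apply: ltn_ord.
Qed.
End Idempotents.

Lemma finitely_many_idem (k : fieldType) (N : nat) (S : 'M[k]_N -> Prop) :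
  S 1%:M -> (forall x y, S x -> S y -> S (x + y)) ->
  (forall x y, S x -> S y -> S (x *m y)) -> (forall c x, S x -> S (c *: x)) ->
  finitely_many (fun e => S e /\ e *m e = e)
    (fun e f => exists u v, [/\ S u, S v, u *m v = e & v *m u = f]).
Proof.
case: N S => [|N] S S1 SD SM SZ; last exact: (finitely_many_idem_pos S1 SD SM SZ).
exists unit, (fun=> tt) => e f [Se _] [Sf _] _; exists e, e.
by split=> //; rewrite [LHS]flatmx0 [RHS]flatmx0.
Qed.

(** * Complexes *)

Definition pack_linear (A : pzRingType) (M N : lmodType A) (f : M -> N)
    (lf : linear f) : {linear M -> N} :=
  HB.pack f (GRing.isLinear.Build A M N *:%R f lf).

Section Complexes.
Variable A : pzRingType.
Implicit Types X Y Z W : bcomplex A.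

Lemma coboundaryP X i (x : X i) :
  coboundary x <-> exists j (y : X j), x = diff X j i y.
Proof.
split=> [[y ->]|[j [y ->]]]; first by exists (i - 1), y.
have [ji|ne] := eqVneq j (i - 1); first by subst j; exists y.
by exists 0; rewrite linear0 diff_shape // -subr_eq eq_sym.
Qed.


Lemma coboundary_at X i j (x : X i) :
  i = j + 1 -> coboundary x -> exists y : X j, x = diff X j i y.
Proof.
move=> ij /coboundaryP[l [y ->]].
have [lj|ne] := eqVneq l j; first by subst l; exists y.
exists 0; rewrite linear0 diff_shape // ij.
by apply: contraNneq ne => /addIr ->.
Qed.

Lemma cocycleD X i (x y : X i) : cocycle x -> cocycle y -> cocycle (x + y).
Proof. by rewrite /cocycle linearD => -> ->; rewrite addr0. Qed.

Lemma cocycleZ X i a (x : X i) : cocycle x -> cocycle (a *: x).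
Proof. by rewrite /cocycle linearZ /= => ->; rewrite scaler0. Qed.

Lemma cocycle0 X i : cocycle (0 : X i).
Proof. exact: linear0. Qed.

Lemma cocycleB X i (x y : X i) : cocycle x -> cocycle y -> cocycle (x - y).
Proof. by rewrite /cocycle linearB => -> ->; rewrite subr0. Qed.

Lemma cocycle_diff X i j (x : X i) : cocycle (diff X i j x).
Proof. exact: diffK. Qed.

Lemma cocycle_cmap X Y (f : chain_map X Y) i (x : X i) :
  cocycle x -> cocycle (f i x).
Proof. by rewrite /cocycle -cmap_diff => ->; rewrite linear0. Qed.

Lemma coboundaryD X i (x y : X i) :
  coboundary x -> coboundary y -> coboundary (x + y).
Proof. by move=> [u ->] [v ->]; exists (u + v); rewrite linearD. Qed.

Lemma coboundaryZ X i a (x : X i) : coboundary x -> coboundary (a *: x).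
Proof. by move=> [u ->]; exists (a *: u); rewrite linearZ. Qed.

Lemma coboundaryN X i (x : X i) : coboundary x -> coboundary (- x).
Proof. by move=> [u ->]; exists (- u); rewrite linearN. Qed.

Lemma coboundary0 X i : coboundary (0 : X i).
Proof. by exists 0; rewrite linear0. Qed.

Lemma coboundary_diff X i j (x : X i) : coboundary (diff X i j x).
Proof. by apply/coboundaryP; exists i, x. Qed.

Lemma coboundary_cocycle X i (x : X i) : coboundary x -> cocycle x.
Proof. by move=> [y ->]; apply: cocycle_diff. Qed.

Lemma coboundary_cmap X Y (f : chain_map X Y) i (x : X i) :
  coboundary x -> coboundary (f i x).
Proof. by move=> [y ->]; exists (f _ y); rewrite cmap_diff. Qed.

Definition cohomologous X i (x y : X i) := coboundary (x - y).

Lemma cohomologous_refl X i (x : X i) : cohomologous x x.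
Proof. by rewrite /cohomologous subrr; apply: coboundary0. Qed.

Lemma cohomologous_sym X i (x y : X i) : cohomologous x y -> cohomologous y x.
Proof. by move=> /coboundaryN; rewrite opprB. Qed.

Lemma cohomologous_trans X i (y x z : X i) :
  cohomologous x y -> cohomologous y z -> cohomologous x z.
Proof. by move=> xy /(coboundaryD xy); rewrite addrA subrK. Qed.

Lemma cohomologous_cmap X Y (f : chain_map X Y) i (x y : X i) :
  cohomologous x y -> cohomologous (f i x) (f i y).
Proof. by move=> /(coboundary_cmap f); rewrite linearB. Qed.

Lemma cohomologousD X i (x y x' y' : X i) :
  cohomologous x y -> cohomologous x' y' -> cohomologous (x + x') (y + y').
Proof. by move=> xy /(coboundaryD xy); rewrite addrACA -opprD. Qed.

Lemma cohomologousZ X i a (x y : X i) :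
  cohomologous x y -> cohomologous (a *: x) (a *: y).
Proof. by move=> /(coboundaryZ a); rewrite scalerBr. Qed.

Lemma coboundary_cohomologous X i (x y : X i) :
  cohomologous x y -> coboundary y -> coboundary x.
Proof. by move=> xy /(coboundaryD xy); rewrite subrK. Qed.

Lemma quasi_isoP X Y (f : chain_map X Y) : quasi_iso f <->
  (forall i (x : X i), cocycle x -> coboundary (f i x) -> coboundary x) /\
  (forall i (y : Y i), cocycle y ->
    exists2 x : X i, cocycle x & cohomologous y (f i x)).
Proof.
split=> [q|[q1 q2] i].
  split=> i; first by have [] := q i.
  by move=> y /(proj2 (q i))[x []]; exists x.
split; first exact: q1.
by move=> y /q2[x]; exists x.
Qed.

Lemma quasi_iso_id X : quasi_iso (chain_id X).
Proof.
apply/quasi_isoP; split=> // i y cy; exists y => //; exact: cohomologous_refl.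
Qed.

Lemma quasi_iso_comp X Y Z (g : chain_map Y Z) (f : chain_map X Y) :
  quasi_iso g -> quasi_iso f -> quasi_iso (chain_comp g f).
Proof.
move=> /quasi_isoP[g1 g2] /quasi_isoP[f1 f2]; apply/quasi_isoP; split=> i.
  by move=> x cx /g1 b; apply/f1 => //; apply/b/cocycle_cmap.
move=> z /g2[y cy zy]; have [x cx yx] := f2 _ _ cy; exists x => //.
exact: cohomologous_trans zy (cohomologous_cmap g yx).
Qed.

Lemma homotopic_cohomologous X Y (f g : chain_map X Y) : homotopic f g ->
  forall i (x : X i), cocycle x -> cohomologous (f i x) (g i x).
Proof.
move=> [h hP] i x cx; rewrite /cohomologous hP cx linear0 addr0.
exact: coboundary_diff.
Qed.

Lemma homotopic_eq X Y (f g : chain_map X Y) :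
  (forall i x, f i x = g i x) -> homotopic f g.
Proof.
move=> fg; exists (fun i j => \0 : {linear X i -> Y j}) => i x.
by rewrite fg subrr linear0 addr0.
Qed.

(** * Action of the derived category on cohomology *)

Fixpoint der_act X Y (u : der_hom X Y) : forall i, X i -> Y i :=
  match u with
  | der_map _ _ f => fun i => f i
  | der_inv X Y s _ => fun i y =>
      xget 0 [set x : X i | cocycle x /\ cohomologous y (s i x)]%classic
  | der_comp _ _ _ v u => fun i x => der_act v (der_act u x)
  end.

Lemma der_act_inv X Y (s : chain_map X Y) (qs : quasi_iso s) i (y : Y i) :
  cocycle y -> cocycle (der_act (der_inv qs) y) /\
    cohomologous y (s i (der_act (der_inv qs) y)).
Proof.
move=> cy; have [x cx yx] := proj2 (iffLR (quasi_isoP s) qs) i y cy.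
exact: (@xgetPex _ 0 [set x : X i | cocycle x /\ cohomologous y (s i x)]%classic
  (ex_intro _ x (conj cx yx))).
Qed.

Lemma quasi_iso_inj X Y (s : chain_map X Y) : quasi_iso s ->
  forall i (x x' : X i), cocycle x -> cocycle x' ->
  cohomologous (s i x) (s i x') -> cohomologous x x'.
Proof.
move=> /quasi_isoP[s1 _] i x x' cx cx'; rewrite /cohomologous -linearB.
by apply/s1/cocycleB.
Qed.

Lemma der_act_cocycle X Y (u : der_hom X Y) i (x : X i) :
  cocycle x -> cocycle (der_act u x).
Proof.
elim: X Y / u i x => [X Y f|X Y s qs|X Y Z v IHv u IHu] i x cx.
- exact: cocycle_cmap.
- by have [] := der_act_inv qs cx.
- by apply/IHv/IHu.
Qed.

Lemma der_act_cohomologous X Y (u : der_hom X Y) i (x x' : X i) :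
  cocycle x -> cocycle x' -> cohomologous x x' ->
  cohomologous (der_act u x) (der_act u x').
Proof.
elim: X Y / u i x x' => [X Y f|X Y s qs|X Y Z v IHv u IHu] i x x' cx cx' xx'.
- exact: cohomologous_cmap.
- have [c1 h1] := der_act_inv qs cx; have [c2 h2] := der_act_inv qs cx'.
  apply: (quasi_iso_inj qs) => //; apply: cohomologous_trans h2.
  by apply: cohomologous_trans (cohomologous_sym h1) xx'.
- by apply: IHv; [apply: der_act_cocycle..|apply: IHu].
Qed.

Lemma der_act_linear X Y (u : der_hom X Y) i a (x y : X i) :
  cocycle x -> cocycle y ->
  cohomologous (der_act u (a *: x + y)) (a *: der_act u x + der_act u y).
Proof.
have lin X' i' a' (x' y' : X' i') : cocycle x' -> cocycle y' -> cocycle (a' *: x' + y').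
  by move=> cx cy; apply: cocycleD => //; apply: cocycleZ.
elim: X Y / u i a x y => [X Y f|X Y s qs|X Y Z v IHv u IHu] i a x y cx cy.
- by rewrite /= linearP; apply: cohomologous_refl.
- have [c1 h1] := der_act_inv qs cx; have [c2 h2] := der_act_inv qs cy.
  have [c3 h3] := der_act_inv qs (lin _ _ a _ _ cx cy).
  apply: (quasi_iso_inj qs) => //; first exact: lin.
  apply: cohomologous_trans (cohomologous_sym h3) _.
  by rewrite linearP; apply: cohomologousD h2; apply: cohomologousZ.
- apply: cohomologous_trans (IHv _ _ _ _ (der_act_cocycle u cx) (der_act_cocycle u cy)).
  apply: der_act_cohomologous (IHu _ _ _ _ cx cy).
    by apply/der_act_cocycle/lin.
  by apply: lin; apply: der_act_cocycle.
Qed.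

Lemma der_act_eq X Y (u v : der_hom X Y) : der_eq u v ->
  forall i (x : X i), cocycle x -> cohomologous (der_act u x) (der_act v x).
Proof.
elim=> {X Y u v} /=.
- by move=> X Y u i x _; apply: cohomologous_refl.
- by move=> X Y u v _ IH i x cx; apply/cohomologous_sym/IH.
- by move=> X Y u v w _ IH _ IH' i x cx; apply: cohomologous_trans (IH _ _ cx) (IH' _ _ cx).
- move=> X Y Z v v' u u' _ IH _ IH' i x cx.
  apply: cohomologous_trans (IH _ _ (der_act_cocycle u cx)) _.
  by apply: der_act_cohomologous (IH' _ _ cx); apply: der_act_cocycle.
- by move=> *; apply: cohomologous_refl.
- by move=> *; apply: cohomologous_refl.
- by move=> *; apply: cohomologous_refl.
- by move=> *; apply: cohomologous_refl.
- by move=> X Y f g fg i x cx; apply: homotopic_cohomologous.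
- move=> X Y s qs i x cx.
  have [c h] := der_act_inv qs (cocycle_cmap s cx).
  by apply: (quasi_iso_inj qs) => //; apply: cohomologous_sym.
- by move=> X Y s qs i y /(der_act_inv qs)[_ /cohomologous_sym].
Qed.
End Complexes.

(** * Mapping cones and roofs *)

Section IndexCast.
Variables (A : pzRingType) (X : int -> fgmod A).

Definition idx_cast_fun (i j : int) (x : X i) : X j :=
  if @eqP _ i j is ReflectT e then ecast m (X m) e x else 0.

Lemma idx_cast_linear i j : linear (@idx_cast_fun i j).
Proof.
rewrite /idx_cast_fun => a x y; case: eqP => [e|_]; first by case: _ / e.
by rewrite scaler0 addr0.
Qed.

Lemma idx_cast_exists i j : {f : {linear X i -> X j} |
  forall x, f x = if @eqP _ i j is ReflectT e then ecast m (X m) e x else 0}.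
Proof. by exists (pack_linear (@idx_cast_linear i j)). Qed.

Definition idx_cast i j := sval (idx_cast_exists i j).

Lemma idx_cast_id i (x : X i) : idx_cast i i x = x.
Proof.
rewrite /idx_cast; case: idx_cast_exists => f /= ->.
by case: eqP => // e; rewrite eq_axiomK.
Qed.

Lemma idx_cast_neq i j (x : X i) : i != j -> idx_cast i j x = 0.
Proof. by rewrite /idx_cast; case: idx_cast_exists => f /= ->; case: eqP. Qed.
End IndexCast.

Section Cone.
Variable A : pzRingType.
Implicit Types X Y Z W : bcomplex A.

Lemma idx_cast_diff X i j l (x : X (i + 1)) :
  diff X j l (idx_cast X (i + 1) j x) =
  idx_cast X (j + 1) l (diff X (i + 1) (j + 1) x).
Proof.
have [ij|ij] := eqVneq (i + 1) j; last first.
  rewrite idx_cast_neq // linear0 diff_shape ?linear0 //.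
  by rewrite (inj_eq (addIr 1)) eq_sym.
subst j; rewrite idx_cast_id.
have [il|il] := eqVneq (i + 1 + 1) l; first by subst l; rewrite idx_cast_id.
by rewrite idx_cast_neq // diff_shape // eq_sym.
Qed.

Lemma cocycle_idx_cast X i j (x : X i) : cocycle x -> cocycle (idx_cast X i j x).
Proof.
have [ij|ij] := eqVneq i j; first by subst j; rewrite idx_cast_id.
by rewrite idx_cast_neq // => _; apply: cocycle0.
Qed.

Lemma coboundary_idx_cast X i j (x : X i) :
  coboundary x -> coboundary (idx_cast X i j x).
Proof.
have [ij|ij] := eqVneq i j; first by subst j; rewrite idx_cast_id.
by rewrite idx_cast_neq // => _; apply: coboundary0.
Qed.

Lemma finitely_generated_prod (M N : lmodType A) :
  finitely_generated M -> finitely_generated N ->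
  finitely_generated ((M * N)%type : lmodType A).
Proof.
move=> [m [g gP]] [n [h hP]].
exists (m + n)%N, (fun i => match fintype.split i with
  inl j => (g j, 0) | inr j => (0, h j) end).
move=> [x y]; have [a ->] := gP x; have [b ->] := hP y.
exists (fun i => match fintype.split i with inl j => a j | inr j => b j end).
have sl i : fintype.split (lshift n i) = inl i := unsplitK (inl i : 'I_m + 'I_n).
have sr i : fintype.split (rshift m i) = inr i := unsplitK (inr i : 'I_m + 'I_n).
rewrite big_split_ord /=.
under [X in _ = X + _]eq_bigr do rewrite sl.
under [X in _ = _ + X]eq_bigr do rewrite sr.
apply: injective_projections; rewrite /= !raddf_sum /=.
  by rewrite [X in _ + X]big1 ?addr0 // => i _; rewrite scaler0.
by rewrite [X in X + _]big1 ?add0r // => i _; rewrite scaler0.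
Qed.

Variables (X Y W : bcomplex A) (s : chain_map W X) (f : chain_map W Y).

Definition cone_obj (i : int) : fgmod A :=
  FgMod (finitely_generated_prod
    (finitely_generated_prod (fgmodP (X i)) (fgmodP (Y i)))
    (fgmodP (W (i + 1)))).

Definition cone_diff_fun i j (p : cone_obj i) : cone_obj j :=
  (diff X i j p.1.1 + idx_cast X (i + 1) j (s (i + 1) p.2),
   diff Y i j p.1.2 - idx_cast Y (i + 1) j (f (i + 1) p.2),
   - diff W (i + 1) (j + 1) p.2).

Lemma cone_diff_linear i j : linear (@cone_diff_fun i j).
Proof.
move=> a [[x y] w] [[x' y'] w']; rewrite /cone_diff_fun /= !linearP /=.
congr (_, _, _).
- rewrite -[RHS]/(a *: (diff X i j x + idx_cast X (i + 1) j (s (i + 1) w)) +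
    (diff X i j x' + idx_cast X (i + 1) j (s (i + 1) w'))).
  by rewrite scalerDr addrACA.
- rewrite -[RHS]/(a *: (diff Y i j y - idx_cast Y (i + 1) j (f (i + 1) w)) +
    (diff Y i j y' - idx_cast Y (i + 1) j (f (i + 1) w'))).
  by rewrite scalerDr addrACA.

Qed.

Definition cone_diff i j : {linear cone_obj i -> cone_obj j} :=
  pack_linear (@cone_diff_linear i j).

Lemma cone_diffE i j (p : cone_obj i) : cone_diff i j p =
  (diff X i j p.1.1 + idx_cast X (i + 1) j (s (i + 1) p.2),
   diff Y i j p.1.2 - idx_cast Y (i + 1) j (f (i + 1) p.2),
   - diff W (i + 1) (j + 1) p.2).
Proof. by []. Qed.

Lemma cone_diff_shape i j : j != i + 1 -> forall x, cone_diff i j x = 0.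
Proof.
move=> ij x; rewrite cone_diffE !diff_shape ?idx_cast_neq ?oppr0 ?addr0 //.
- by rewrite eq_sym.
- by rewrite eq_sym.
- by apply: contraNN ij => /eqP ij; apply/eqP; lia.
Qed.

Lemma cone_diffK i j l x : cone_diff j l (cone_diff i j x) = 0.
Proof.
rewrite !cone_diffE /= !linearD !linearN /= !diffK !idx_cast_diff -!cmap_diff.
by rewrite !add0r !subrr !oppr0.
Qed.

Lemma cone_bounded : exists n : nat, forall i : int,
  n%:Z < `|i| -> forall x : cone_obj i, x = 0.
Proof.
have [m mP] := cbounded X; have [n nP] := cbounded Y; have [p pP] := cbounded W.
exists (m + n + p + 1)%N => i li [[x y] w].
by rewrite (mP i _ x) ?(nP i _ y) ?(pP (i + 1) _ w) //; lia.
Qed.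

Definition cone : bcomplex A := BComplex cone_diff_shape cone_diffK cone_bounded.

Lemma cone_inl_linear i : linear (fun x : X i => ((x, 0), 0) : cone i).
Proof. by move=> a x y; congr (_, _, _); rewrite /= scaler0 addr0. Qed.

Lemma cone_inr_linear i : linear (fun y : Y i => ((0, y), 0) : cone i).
Proof. by move=> a x y; congr (_, _, _); rewrite /= scaler0 addr0. Qed.

Definition cone_inl : chain_map X cone.
Proof.
refine (@ChainMap _ X cone (fun i => pack_linear (@cone_inl_linear i)) _) => i j x.
by rewrite /= /cone_diff_fun /= !linear0 !addr0.
Defined.

Definition cone_inr : chain_map Y cone.
Proof.
refine (@ChainMap _ Y cone (fun i => pack_linear (@cone_inr_linear i)) _) => i j x.
by rewrite /= /cone_diff_fun /= !linear0 !addr0.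
Defined.

Lemma cone_htpy_linear i j :
  linear (fun w : W i => ((0, 0), idx_cast W i (j + 1) w) : cone j).
Proof.
by move=> a x y; rewrite linearP; congr (_, _, _); rewrite /= scaler0 addr0.
Qed.

Lemma cone_homotopic : homotopic (chain_comp cone_inl s) (chain_comp cone_inr f).
Proof.
exists (fun i j => pack_linear (@cone_htpy_linear i j)) => i w.
rewrite /= /cone_diff_fun /=.
have [a e] : {a | i - 1 + 1 = a} by exists (i - 1 + 1).
have ai : a = i by rewrite -e subrK.
rewrite e; subst a; rewrite ai !idx_cast_id !linear0 !add0r.
by congr (_, _, _); rewrite /= ?subr0 ?sub0r ?addr0 ?addNr.
Qed.

Lemma cone_inr_quasi_iso : quasi_iso s -> quasi_iso cone_inr.
Proof.
move=> /quasi_isoP[s1 s2]; apply/quasi_isoP; split=> i.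
  move=> y cy /coboundaryP[j [[[x y'] w]]].
  rewrite /= /cone_diff_fun /= => -[ex -> ew].
  have [ji|ji] := eqVneq (j + 1) i; last first.
    by rewrite idx_cast_neq // subr0; apply: coboundary_diff.
  subst i; move: ex ew; rewrite !idx_cast_id => /esym/eqP.
  rewrite addr_eq0 => /eqP /esym/(congr1 -%R); rewrite opprK => sw.
  move=> /esym/eqP; rewrite oppr_eq0 => /eqP dw.
  have [v ->] : coboundary w.
    by apply: s1 => //; rewrite sw -linearN; apply: coboundary_diff.
  rewrite cmap_diff; apply: coboundaryD; first exact: coboundary_diff.
  exact/coboundaryN/coboundary_diff.
move=> [[x y] w]; rewrite /cocycle /= /cone_diff_fun /= !idx_cast_id.
move=> [/eqP + dy /eqP dw]; rewrite [diff _ _ _ _ + _]addrC addr_eq0 => /eqP sw.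
have {}dw : cocycle w by apply/eqP; rewrite -oppr_eq0.
have [|v wE] := coboundary_at (erefl (i + 1)) (s1 _ _ dw _).
  by rewrite sw; apply/coboundaryN/coboundary_diff.
have [|w' cw' [x' xE]] := s2 i (x + s i v).
  by rewrite /cocycle linearD -cmap_diff -wE sw subrr.
have [u [du xE']] : exists u, diff W i (i + 1) u = w /\ x + s i u = diff X (i - 1) i x'.
  exists (v - w'); rewrite !linearB -wE (_ : diff W _ _ w' = 0) // subr0.
  by rewrite addrA xE.
exists (y - f i u); first by rewrite linearB -cmap_diff du.
have [a e] : {a | i - 1 + 1 = a} by exists (i - 1 + 1).
exists (x', 0, - idx_cast W i (i - 1 + 1) u).
rewrite /= /cone_diff_fun /=.
have ai : a = i by rewrite -e subrK.
rewrite e; subst a; rewrite ai !linearN !idx_cast_id !opprK -xE' du linear0 add0r.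
by congr (_, _, _); rewrite /= ?subr0 ?addrK // opprD opprK addrA subrr add0r.
Qed.
End Cone.

Section Roofs.
Variable A : pzRingType.
Implicit Types X Y Z W : bcomplex A.

Lemma der_inv_comp X Y Z (t : chain_map X Y) (u : chain_map Y Z)
    (qt : quasi_iso t) (qu : quasi_iso u) :
  der_eq (der_comp (der_inv qt) (der_inv qu)) (der_inv (quasi_iso_comp qu qt)).
Proof.
set w := der_inv (quasi_iso_comp qu qt); set v := der_comp _ _.
apply: der_eq_trans (der_eq_sym (der_eq_1l v)) _.
apply: der_eq_trans (der_eq_comp
  (der_eq_sym (der_eq_invl (quasi_iso_comp qu qt))) (der_eq_refl v)) _.
apply: der_eq_trans (der_eq_sym (der_eq_assoc _ _ _)) _.
apply: der_eq_trans (der_eq_1r w); apply: der_eq_comp; first exact: der_eq_refl.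
apply: der_eq_trans (der_eq_comp (der_eq_map_comp _ _) (der_eq_refl _)) _.
apply: der_eq_trans (der_eq_sym (der_eq_assoc _ _ _)) _.
apply: der_eq_trans (der_eq_invr qu); apply: der_eq_comp; first exact: der_eq_refl.
apply: der_eq_trans (der_eq_assoc _ _ _) _.
apply: der_eq_trans (der_eq_1l _); apply: der_eq_comp; last exact: der_eq_refl.
exact: der_eq_invr.
Qed.

Lemma ore X Y W (t : chain_map W X) (f : chain_map W Y) (qt : quasi_iso t) :
  der_eq (der_comp (der_map f) (der_inv qt))
    (der_comp (der_inv (cone_inr_quasi_iso f qt)) (der_map (cone_inl t f))).
Proof.
set g := cone_inl t f; set j := cone_inr t f; set qj := cone_inr_quasi_iso f qt.
have gj : der_eq (der_comp (der_map g) (der_map t)) (der_comp (der_map j) (der_map f)).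
  apply: der_eq_trans (der_eq_sym (der_eq_map_comp _ _)) _.
  apply: der_eq_trans (der_eq_map_comp _ _).
  exact/der_eq_homotopic/cone_homotopic.
have fE : der_eq (der_map f) (der_comp (der_inv qj) (der_comp (der_map g) (der_map t))).
  apply: der_eq_trans (der_eq_comp (der_eq_refl _) (der_eq_sym gj)).
  apply: der_eq_trans (der_eq_sym (der_eq_assoc _ _ _)).
  apply: der_eq_trans (der_eq_sym (der_eq_1l _)) _.
  by apply: der_eq_comp (der_eq_refl _); apply/der_eq_sym/der_eq_invl.
apply: der_eq_trans (der_eq_comp fE (der_eq_refl _)) _.
apply: der_eq_trans (der_eq_sym (der_eq_assoc _ _ _)) _.
apply: der_eq_comp (der_eq_refl _) _.
apply: der_eq_trans (der_eq_sym (der_eq_assoc _ _ _)) _.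
apply: der_eq_trans (der_eq_1r _); apply: der_eq_comp (der_eq_refl _) _.
exact: der_eq_invr.
Qed.

Lemma der_roof X Y (u : der_hom X Y) :
  exists V (g : chain_map X V) (t : chain_map Y V) (qt : quasi_iso t),
    der_eq u (der_comp (der_inv qt) (der_map g)).
Proof.
elim: X Y / u => [X Y f|X Y s qs|X Y Z v [Q [g' [t' [qt' vE]]]] u [P [g [t [qt uE]]]]].
- exists Y, f, (chain_id Y), (quasi_iso_id Y).
  apply: der_eq_trans (der_eq_sym (der_eq_1l _)) _; apply: der_eq_comp (der_eq_refl _).
  apply: der_eq_trans (der_eq_sym (der_eq_invl (quasi_iso_id Y))) _.
  exact: der_eq_1r.
- by exists Y, (chain_id Y), s, qs; apply/der_eq_sym/der_eq_1r.
exists (cone t g'), (chain_comp (cone_inl t g') g), (chain_comp (cone_inr t g') t').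
exists (quasi_iso_comp (cone_inr_quasi_iso g' qt) qt').
apply: der_eq_trans (der_eq_comp vE uE) _.
apply: der_eq_trans (der_eq_comp (der_inv_comp _ _) (der_eq_sym (der_eq_map_comp _ _))).
apply: der_eq_trans (der_eq_assoc _ _ _).
apply: der_eq_trans (der_eq_sym (der_eq_assoc _ _ _)) _.
apply: der_eq_comp (der_eq_refl _) _.
apply: der_eq_trans (der_eq_assoc _ _ _) _.
apply: der_eq_trans (der_eq_sym (der_eq_assoc _ _ _)).
by apply: der_eq_comp (der_eq_refl _); apply: ore.
Qed.

Lemma der_iso_of_act X (u : der_hom X X) :
  (forall i (x : X i), cocycle x -> cohomologous (der_act u x) x) ->
  exists2 v : der_hom X X, der_eq (der_comp v u) (der_id X) &
    der_eq (der_comp u v) (der_id X).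
Proof.
have [V [g [t [qt uE]]]] := der_roof u; move=> uP.
have gt i (x : X i) : cocycle x -> cohomologous (g i x) (t i x).
  move=> cx; have [c] := der_act_inv qt (cocycle_cmap g cx).
  move=> /cohomologous_trans; apply; apply: cohomologous_cmap.
  apply: cohomologous_trans (uP _ _ cx).
  exact/cohomologous_sym/(der_act_eq uE).
have qg : quasi_iso g.
  have [t1 t2] := iffLR (quasi_isoP t) qt; apply/quasi_isoP; split=> i.
    move=> x cx gx; apply: t1 => //.
    by apply: coboundary_cohomologous gx; apply/cohomologous_sym/gt.
  move=> y /t2[x cx yx]; exists x => //.
  by apply: cohomologous_trans yx _; apply/cohomologous_sym/gt.
have cancel (P Q R : bcomplex A) (a : der_hom Q R) (b : der_hom R Q)
    (c : der_hom P Q) (d : der_hom Q P) :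
    der_eq (der_comp b a) (der_id Q) -> der_eq (der_comp d c) (der_id P) ->
    der_eq (der_comp (der_comp d b) (der_comp a c)) (der_id P).
  move=> ba dc; apply: der_eq_trans dc; apply: der_eq_trans (der_eq_sym (der_eq_assoc _ _ _)) _.
  apply: der_eq_comp (der_eq_refl _) _; apply: der_eq_trans (der_eq_assoc _ _ _) _.
  by apply: der_eq_trans (der_eq_1l _); apply: der_eq_comp (der_eq_refl _).
exists (der_comp (der_inv qg) (der_map t)).
  apply: der_eq_trans (der_eq_comp (der_eq_refl _) uE) _.
  by apply: cancel; [apply: der_eq_invr|apply: der_eq_invl].
apply: der_eq_trans (der_eq_comp uE (der_eq_refl _)) _.
by apply: cancel; [apply: der_eq_invr|apply: der_eq_invl].
Qed.

Lemma chain_add_subproof X Y (f g : chain_map X Y) i j (x : X i) :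
  (f j \+ g j) (diff X i j x) = diff Y i j ((f i \+ g i) x).
Proof. by rewrite /= !cmap_diff linearD. Qed.

Definition chain_add X Y (f g : chain_map X Y) : chain_map X Y :=
  @ChainMap _ X Y (fun i => f i \+ g i) (chain_add_subproof f g).

Lemma der_act_add X Y (u v : der_hom X Y) : exists w : der_hom X Y,
  forall i (x : X i), cocycle x ->
    cohomologous (der_act w x) (der_act u x + der_act v x).
Proof.
have [P [g [t [qt uE]]]] := der_roof u; have [Q [g' [t' [qt' vE]]]] := der_roof v.
pose jP := cone_inl t t'; pose jQ := cone_inr t t'.
have qj : quasi_iso jQ := cone_inr_quasi_iso t' qt.
pose q := quasi_iso_comp qj qt'.
exists (der_comp (der_inv q) (der_map (chain_add (chain_comp jP g) (chain_comp jQ g')))).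
move=> i x cx; set f := chain_add _ _.
have [cw wP] := der_act_inv q (cocycle_cmap f cx).
have act Z R (h : chain_map X R) (r : chain_map Z R) (qr : quasi_iso r) a :
    der_eq a (der_comp (der_inv qr) (der_map h)) ->
    cohomologous (r i (der_act a x)) (h i x).
  move=> aE; have [c cP] := der_act_inv qr (cocycle_cmap h cx).
  apply: cohomologous_sym; apply: cohomologous_trans cP _.
  by apply/cohomologous_cmap/cohomologous_sym/(der_act_eq aE).
apply: (quasi_iso_inj q) => //.
  by apply: cocycleD; apply: der_act_cocycle.
apply: cohomologous_trans (cohomologous_sym wP) _.
rewrite linearD; apply: cohomologousD.
  apply: cohomologous_trans (homotopic_cohomologous (cone_homotopic t t') (der_act_cocycle u cx)).
  apply: (@cohomologous_cmap _ _ _ jP i (g i x) (t i _)).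
  exact/cohomologous_sym/(act _ _ _ _ qt).
apply: (@cohomologous_cmap _ _ _ jQ i (g' i x) (t' i _)).
exact/cohomologous_sym/(act _ _ _ _ qt').
Qed.
End Roofs.

(** * Dimensions over the ground field *)

Lemma vspace_of_closed (k : fieldType) (vT : vectType k) (P : vT -> Prop) :
  P 0 -> (forall c x y, P x -> P y -> P (c *: x + y)) ->
  exists U : {vspace vT}, forall x, (x \in U) <-> P x.
Proof.
move=> P0 Plin.
have ext n (U : {vspace vT}) : (dim vT - \dim U <= n)%N -> (forall x, x \in U -> P x) ->
    exists U : {vspace vT}, forall x, (x \in U) <-> P x.
  elim: n U => [|n IH] U dU UP.
    exists U => x; split; first exact: UP.
    have /eqP -> : U == fullv; last by rewrite memvf.
    rewrite -(dimv_leqif_eq (subvf U)) eqn_leq dimvS ?subvf //= dimvf.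
    by rewrite -subn_eq0 -leqn0.
  have [[x [Px xU]]|nx] := pselect (exists x, P x /\ x \notin U); last first.
    exists U => x; split; first exact: UP.
    by move=> Px; apply: contrapT => /negP xU; apply: nx; exists x.
  apply: (IH (U + <[x]>)%VS); last first.
    by move=> _ /memv_addP[u uU [_ /vlineP[c ->] ->]]; rewrite addrC; apply: Plin => //; apply: UP.
  have lt : (\dim U < \dim (U + <[x]>))%N.
    rewrite ltn_neqAle dimvS ?addvSl // andbT; apply: contra xU.
    rewrite (dimv_leqif_eq (addvSl _ _)) => /eqP ->.
    by rewrite (subvP (addvSr U <[x]>)) ?memv_line.
  have := dimvS (subvf (U + <[x]>)); rewrite dimvf.
  by move: dU lt; lia.
apply: (ext (dim vT) 0%VS); first exact: leq_subr.
by move=> x; rewrite memv0 => /eqP ->.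
Qed.

Section KDim.
Variables (k : fieldType) (A : falgType k).
Implicit Types M N : lmodType A.

Definition ksubspace M (U : M -> Prop) :=
  U 0 /\ forall c x y, U x -> U y -> U ((c%:A : A) *: x + y).

Definition kspanned M (U : M -> Prop) (d : nat) := exists g : 'I_d -> M,
  forall x, U x -> exists c : 'I_d -> k, x = \sum_(s < d) (c s)%:A *: g s.

Lemma kspannedI M (U : M -> Prop) (I : finType) (g : I -> M) :
  (forall x, U x -> exists c : I -> k, x = \sum_i (c i)%:A *: g i) ->
  kspanned U #|I|.
Proof.
move=> gP; exists (g \o enum_val) => x /gP[c ->]; exists (c \o enum_val).
by rewrite /= -(big_enum_val (fun i => (c i)%:A *: g i)).
Qed.

Lemma kspanned_sub M (U V : M -> Prop) d :
  (forall x, U x -> V x) -> kspanned V d -> kspanned U d.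
Proof. by move=> UV [g gP]; exists g => x /UV/gP. Qed.

Lemma kspanned_leq M (U : M -> Prop) d d' :
  (d <= d')%N -> kspanned U d -> kspanned U d'.
Proof.
move=> le [g gP]; rewrite -(subnKC le).
exists (fun i => if fintype.split i is inl j then g j else 0) => x /gP[c ->].
exists (fun i => if fintype.split i is inl j then c j else 0).
have sl i : fintype.split (lshift (d' - d) i) = inl i := unsplitK (inl i : 'I_d + 'I_(d' - d)).
have sr i : fintype.split (rshift d i) = inr i := unsplitK (inr i : 'I_d + 'I_(d' - d)).
rewrite big_split_ord /= [X in _ + X]big1 ?addr0.
  by apply: eq_bigr => i _; rewrite sl.
by move=> i _; rewrite sr scaler0.
Qed.

Lemma quotient_basis M (C B : M -> Prop) d :
  ksubspace C -> ksubspace B -> (forall x, B x -> C x) -> kspanned C d ->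
  exists n (z : 'I_n -> M), [/\ (n <= d)%N, forall s, C (z s) &
    forall x, C x -> exists! c : {ffun 'I_n -> k},
      B (x - \sum_(s < n) (c s)%:A *: z s)].
Proof.
move=> [C0 Clin] [B0 Blin] BC [g gP].
pose L (v : 'rV[k]_d) := \sum_(s < d) (v 0 s)%:A *: g s.
have Llin c v w : L (c *: v + w) = c%:A *: L v + L w.
  rewrite /L scaler_sumr -big_split /=; apply: eq_bigr => s _.
  by rewrite !mxE scalerA -scalerDl mulr_algl scalerA -scalerDl.
have L0 : L 0 = 0 by rewrite /L big1 // => s _; rewrite mxE scale0r scale0r.
have Lsum n (c : 'I_n -> k) b : L (\sum_(s < n) c s *: b s) = \sum_(s < n) (c s)%:A *: L (b s).
  elim: n c b => [|n IH] c b; first by rewrite !big_ord0.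
  by rewrite !big_ord_recl Llin IH.
have [UC UCP] : exists U : {vspace 'rV[k]_d}, forall v, (v \in U) <-> C (L v).
  by apply: vspace_of_closed => [|c x y]; rewrite ?L0 // Llin; apply: Clin.
have [UB UBP] : exists U : {vspace 'rV[k]_d}, forall v, (v \in U) <-> B (L v).
  by apply: vspace_of_closed => [|c x y]; rewrite ?L0 // Llin; apply: Blin.
pose W := (UC :\: UB)%VS; pose b := vbasis W.
have bP s : (b`_s : 'rV_d) \in W.
  have [sW|sW] := ltnP s (\dim W); first by rewrite vbasis_mem ?mem_nth ?size_tuple.
  by rewrite nth_default ?mem0v // size_tuple.
exists (\dim W), (fun s => L b`_s); split.
- by rewrite (leq_trans (dimvS (subvf _))) // dimvf /dim /= mul1n.
- move=> s; apply/UCP; apply: (subvP (diffvSl UC UB)); exact: bP.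
move=> x Cx; have [v xE] := gP x Cx.
have {}xE : x = L (\row_s v s) by rewrite xE /L; apply: eq_bigr => s _; rewrite mxE.
have : \row_s v s \in UC by apply/UCP; rewrite -xE.
rewrite -[UC](addv_diff_cap UC UB) => /memv_addP[w wW [u]].
rewrite memv_cap => /andP[_ uB] vE.
have xw : x = L w + L u by rewrite xE vE -{1}[w]scale1r Llin !scale1r.
exists [ffun s => coord b s w]; split.
  rewrite (eq_bigr (fun s => (coord b s w)%:A *: L b`_s)); last by move=> s _; rewrite ffunE.
  by rewrite -Lsum -(coord_vbasis wW) xw addrAC subrr add0r; apply/UBP.
move=> c cB; apply/ffunP => s; rewrite ffunE.
have fb : free b by apply: basis_free (vbasisP W).
suff -> : w = \sum_(s < \dim W) c s *: b`_s by rewrite coord_sum_free.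
apply/eqP; rewrite -subr_eq0 -memv0 -(capv_diff UC UB) memv_cap.
have -> /= : w - \sum_(s < \dim W) c s *: b`_s \in W.
  by rewrite memvB // memv_suml // => t _; apply/memvZ/bP.
apply/UBP; rewrite addrC -scaleN1r Llin Lsum.
move: cB; rewrite xw => cB.
have := Blin (-1) _ _ (iffLR (UBP _) uB) cB.
by rewrite !scaleN1r [L w + L u]addrC -addrA addKr addrC.
Qed.

Lemma kspanned_generated M n (g : 'I_n -> M) :
  kspanned (fun x => exists a : 'I_n -> A, x = \sum_(s < n) a s *: g s)
    (n * \dim {:A}).
Proof.
rewrite -[X in kspanned _ (X * _)]card_ord -[X in kspanned _ (_ * X)]card_ord -card_prod.
pose b := vbasis {:A}.
apply: (kspannedI (g := fun p : 'I_n * 'I_(\dim {:A}) => b`_p.2 *: g p.1)).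
move=> _ [a ->]; exists (fun p => coord b p.2 (a p.1)).
rewrite -(pair_big predT predT (fun i j => (coord b j (a i))%:A *: (b`_j *: g i))) /=.
apply: eq_bigr => s _; rewrite {1}(coord_vbasis (memvf (a s))) scaler_suml.
by apply: eq_bigr => j _; rewrite scalerA mulr_algl.
Qed.

Lemma finitely_generated_kspanned M :
  finitely_generated M -> exists d, kspanned (fun _ : M => True) d.
Proof.
move=> [n [g gP]]; exists (n * \dim {:A})%N.
by apply: kspanned_sub (kspanned_generated g) => x _; apply: gP.
Qed.

Lemma ksubspace_cocycle (X : bcomplex A) i : ksubspace (@cocycle _ X i).
Proof.
split=> [|c x y cx cy]; first exact: cocycle0.
by apply: cocycleD => //; apply: cocycleZ.
Qed.

Lemma ksubspace_coboundary (X : bcomplex A) i : ksubspace (@coboundary _ X i).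
Proof.
split=> [|c x y cx cy]; first exact: coboundary0.
by apply: coboundaryD => //; apply: coboundaryZ.
Qed.

Lemma cohomology_dim_le (X : bcomplex A) i d :
  kspanned (fun _ : X i => True) d -> exists2 n, (n <= d)%N & cohomology_dim X i n.
Proof.
move=> Xd; have [n [z [nd zc zP]]] := quotient_basis (ksubspace_cocycle X i)
  (ksubspace_coboundary X i) (@coboundary_cocycle _ X i)
  (kspanned_sub (fun _ _ => I) Xd).
by exists n => //; exists z.
Qed.

Lemma cohomology_dim_ex (X : bcomplex A) i : exists n, cohomology_dim X i n.
Proof.
have [d Xd] := finitely_generated_kspanned (fgmodP (X i)).
by have [n _ cn] := cohomology_dim_le Xd; exists n.
Qed.

End KDim.

(** * Direct summands in the derived category *)

Section Summands.
Variables (k : fieldType) (A : falgType k).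

Lemma cohomology_frame (Z : bcomplex A) : exists (m : nat) (r : 'rV[k]_m -> forall i, Z i),
  [/\ forall c v w i, r (c *: v + w) i = (c%:A : A) *: r v i + r w i,
      forall v i, cocycle (r v i),
      forall t : (forall i, Z i), (forall i, cocycle (t i)) ->
        exists v, forall i, cohomologous (t i) (r v i) &
      forall v, (forall i, coboundary (r v i)) -> v = 0].
Proof.
have [b bP] := cbounded Z.
have [n nP] := choice (cohomology_dim_ex Z).
pose z i : 'I_(n i) -> Z i := projT1 (cid (nP i)).
have zc i s : cocycle (z i s) by exact: (proj1 (projT2 (cid (nP i)))).
have zP i (x : Z i) : cocycle x -> exists! c : {ffun 'I_(n i) -> k},
    coboundary (x - \sum_(s < n i) (c s)%:A *: z i s).
  exact: (proj2 (projT2 (cid (nP i)))).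
pose deg (j : 'I_(b + b).+1) : int := j%:Z - b%:Z.
pose I : finType := {j : 'I_(b + b).+1 & 'I_(n (deg j))}.
pose T := fun j => 'I_(n (deg j)).
pose r (v : 'rV[k]_#|I|) i : Z i := \sum_(p : I)
  (v 0 (enum_rank p))%:A *: idx_cast Z (deg (tag p)) i (z _ (tagged p)).
have degE (i : int) : `|i| <= b%:Z -> exists j, deg j = i.
  move=> ib; have jb : (absz (i + b%:Z)%R < (b + b).+1)%N by lia.
  by exists (Ordinal jb); rewrite /deg /=; lia.
have rdeg v j : r v (deg j) = \sum_(s < n (deg j))
    (v 0 (enum_rank (Tagged T s)))%:A *: z (deg j) s.
  pose F j' (s : T j') := (v 0 (enum_rank (Tagged T s)))%:A *:
    idx_cast Z (deg j') (deg j) (z (deg j') s).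
  rewrite /r (eq_bigr (fun p : I => F (tag p) (tagged p))); last by case.
  rewrite -(sig_big_dep xpredT (fun _ _ => true) F) (bigD1 j) //= [X in _ + X]big1 ?addr0.
    by apply: eq_bigr => s _; rewrite /F idx_cast_id.
  move=> j' ne; apply: big1 => s _; rewrite /F idx_cast_neq ?scaler0 //.
  by apply: contra ne => /eqP/addIr[e]; apply/eqP/val_inj.
exists #|I|, r; split.
- move=> c v w i; rewrite /r scaler_sumr -big_split /=; apply: eq_bigr => p _.
  by rewrite !mxE scalerA -scalerDl mulr_algl scalerA -scalerDl.
- move=> v i; rewrite /r; apply: big_ind => [|x y cx cy|p _].
  + exact: cocycle0.
  + exact: cocycleD.
  + exact/cocycleZ/cocycle_idx_cast.
- move=> t tc; pose c i := projT1 (cid (zP i (t i) (tc i))).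
  exists (\row_q c (deg (tag (enum_val q))) (tagged (enum_val q))) => i.
  have [ib|ib] := Order.TotalTheory.leP `|i| b%:Z; last first.
    rewrite (bP i ib (t i)) (bP i ib (r _ i)); exact: cohomologous_refl.
  have [j <-] := degE i ib; rewrite /cohomologous rdeg.
  have [+ _] := projT2 (cid (zP _ _ (tc (deg j)))).
  congr (coboundary (_ - _)); apply: eq_bigr => s _; rewrite mxE enum_rankK //.
- move=> v vb; apply/rowP => q; rewrite mxE -[q]enum_valK.
  case: (enum_val q) => j s.
  have [c [_ cu]] := zP (deg j) 0 (cocycle0 _ _).
  pose c1 := [ffun s : T j => v 0 (enum_rank (Tagged T s))].
  have c1c : c = c1.
    apply: cu; rewrite sub0r; apply: coboundaryN; move: (vb (deg j)); rewrite rdeg.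
    by congr coboundary; apply: eq_bigr => s' _; rewrite ffunE.
  have c0 : c = [ffun => 0].
    apply: cu; rewrite big1 ?subr0; first exact: coboundary0.
    by move=> s' _; rewrite ffunE scale0r scale0r.
  by have := congr1 (fun f : {ffun _ -> _} => f s) (etrans (esym c1c) c0); rewrite !ffunE.
Qed.

Section ChainScale.
Variables (X : bcomplex A) (c : k).

Lemma scale_central_linear (M : lmodType A) : linear (fun x : M => (c%:A : A) *: x).
Proof. by move=> a x y; rewrite scalerDr !scalerA mulr_algl mulr_algr. Qed.

Definition chain_scale : chain_map X X.
Proof.
refine (@ChainMap _ X X (fun i => pack_linear (@scale_central_linear (X i))) _).
by move=> i j x; rewrite /= linearZ.
Defined.
End ChainScale.

Definition der_summand (X Z : bcomplex A) := exists (i : der_hom X Z) (p : der_hom Z X),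
  der_eq (der_comp p i) (der_id X).

(* Two summands are compared through their idempotents in the finite dimensional
   algebra of those endomorphisms of the total cohomology of [Z] that come from
   the derived category. *)
Lemma finitely_many_summands Z :
  finitely_many (der_summand^~ Z) (@der_isomorphic A).
Proof.
have [m [r [rlin rc rsurj rinj]]] := cohomology_frame Z.
pose rep (u : der_hom Z Z) (M : 'M[k]_m) := forall v i,
  cohomologous (der_act u (r v i)) (r (v *m M) i).
have r0 i : r 0 i = 0.
  by rewrite -[0 in LHS](subrr 0) addrC -scaleN1r rlin !scaleN1r addNr.
have repP (u : der_hom Z Z) : exists M, rep u M.
  have [w wP] : {w : 'I_m -> 'rV[k]_m & forall p i,
      cohomologous (der_act u (r (delta_mx 0 p) i)) (r (w p) i)}.
    apply: (@choice _ _ (fun p v => forall i,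
      cohomologous (der_act u (r (delta_mx 0 p) i)) (r v i))) => p.
    by apply: rsurj => i; apply: der_act_cocycle.
  exists (\matrix_p w p) => v; rewrite [v]row_sum_delta.
  pose Q v := forall i, cohomologous (der_act u (r v i)) (r (v *m \matrix_p w p) i).
  have Qlin c v1 v2 : Q v1 -> Q v2 -> Q (c *: v1 + v2).
    move=> Q1 Q2 i; rewrite rlin mulmxDl -scalemxAl rlin.
    apply: cohomologous_trans (der_act_linear _ _ (rc _ _) (rc _ _)) _.
    by apply: cohomologousD (Q2 i); apply: cohomologousZ.
  have Q0 : Q 0.
    move=> i; rewrite mul0mx r0.
    have := der_act_linear u (-1) (cocycle0 Z i) (cocycle0 Z i).
    by rewrite scaler0 addr0 scaleN1r addNr.
  rewrite -/(Q _); apply: (big_ind Q) => // [v1 v2 Q1 Q2|p _].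
    by rewrite -[v1]scale1r; apply: Qlin.
  rewrite -[_ *: _]addr0; apply: Qlin => // i.
  by rewrite -rowE rowK.
pose S M := exists u, rep u M.
have rep1 : rep (der_id Z) 1%:M.
  by move=> v i; rewrite mulmx1; apply: cohomologous_refl.
have repM u v M N : rep u M -> rep v N -> rep (der_comp v u) (M *m N).
  move=> uM vN w i; rewrite mulmxA; apply: cohomologous_trans (vN _ _).
  by apply: der_act_cohomologous (uM _ _); [apply: der_act_cocycle|].
have rD v w i : r (v + w) i = r v i + r w i.
  by rewrite -[v]scale1r rlin !scale1r.
have rN v w i : r (v - w) i = r v i - r w i.
  by rewrite [v - w]addrC -[- w]scaleN1r rlin !scaleN1r addrC.
have fS := @finitely_many_idem k m S.
have [|||c M [u uM]|I0 [col colP]] := fS.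
- by exists (der_id Z).
- move=> M N [u uM] [v vN]; have [w wP] := der_act_add u v; exists w => x i.
  apply: cohomologous_trans (wP _ _ (rc x i)) _; rewrite mulmxDr rD.
  exact: cohomologousD.
- by move=> M N [u uM] [v vN]; exists (der_comp v u); apply: repM.
- exists (der_comp (der_map (chain_scale Z c)) u) => x i.
  rewrite -scalemxAr -[c *: _]addr0 rlin r0 addr0 /=.
  exact: cohomologousZ.
have [e eP] : {e : bcomplex A -> 'M[k]_m & forall X, der_summand X Z ->
    exists i p, der_eq (der_comp p i) (der_id X) /\ rep (der_comp i p) (e X)}.
  apply: (@choice _ _ (fun X M => der_summand X Z -> exists (i : der_hom X Z) p,
    der_eq (der_comp p i) (der_id X) /\ rep (der_comp i p) M)) => X.
  have [[i [p pi]]|nX] := pselect (der_summand X Z); last by exists 0.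
  by have [M MP] := repP (der_comp i p); exists M => _; exists i, p.
have rep_inj u v M N : rep u M -> rep v N -> der_eq u v -> M = N.
  move=> uM vN uv; apply/row_matrixP => p; apply/eqP; rewrite -subr_eq0.
  apply/eqP/rinj => i; rewrite rN !rowE.
  apply: cohomologous_trans (vN _ _); apply: cohomologous_sym.
  apply: cohomologous_trans (uM _ _); apply/cohomologous_sym.
  by apply: der_act_eq uv _ _ (rc _ _).
have repI X : der_summand X Z -> S (e X) /\ e X *m e X = e X.
  move=> /eP[i [p [pi ip]]]; split; first by exists (der_comp i p).
  apply: rep_inj (repM _ _ _ _ ip ip) ip _.
  apply: der_eq_trans (der_eq_sym (der_eq_assoc _ _ _)) _.
  apply: der_eq_comp (der_eq_refl _) _.
  apply: der_eq_trans (der_eq_assoc _ _ _) _.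
  by apply: der_eq_trans (der_eq_1l _); apply: der_eq_comp (der_eq_refl _).
exists I0, (col \o e) => X X' sX sX' cXX'.
have [U [V [[u uU] [v vV] UV VU]]] := colP _ _ (repI X sX) (repI X' sX') cXX'.
have [i [p [pi ip]]] := eP X sX; have [i' [p' [pi' ip']]] := eP X' sX'.
have half (Y Y' : bcomplex A) (j : der_hom Y Z) (q : der_hom Z Y) (j' : der_hom Y' Z)
    (q' : der_hom Z Y') M M' a b P Q :
    der_eq (der_comp q j) (der_id Y) ->
    rep (der_comp j q) M -> rep (der_comp j' q') M' -> M *m M = M ->
    rep a P -> rep b Q -> P *m Q = M -> Q *m P = M' ->
    forall n (x : Y n), cocycle x -> cohomologous
      (der_act (der_comp (der_comp (der_comp q b) j') (der_comp (der_comp q' a) j)) x) x.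
  move=> qj jM j'M' MM aP bQ PQ QP n x cx.
  have [|w] := rsurj (fun l => idx_cast Z n l (der_act j x)).
    by move=> l; apply/cocycle_idx_cast/der_act_cocycle.
  move=> /(_ n); rewrite idx_cast_id => wP.
  have step u1 N y w1 : rep u1 N -> cocycle y -> cohomologous y (r w1 n) ->
      cohomologous (der_act u1 y) (r (w1 *m N) n).
    by move=> u1N cy yw; apply: cohomologous_trans (u1N _ _); apply: der_act_cohomologous.
  have cj : cocycle (der_act j x) := der_act_cocycle j cx.
  have qjx := der_act_eq qj cx.
  have {}wP : cohomologous (der_act j x) (r (w *m M) n).
    apply: cohomologous_trans (step _ _ _ _ jM cj wP); apply: cohomologous_sym.
    by apply: der_act_cohomologous qjx => //; do 2?apply: der_act_cocycle.
  have aw := step _ _ _ _ aP cj wP.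
  have j'w := step _ _ _ _ j'M' (der_act_cocycle _ cj) aw.
  have := step _ _ _ _ bQ (der_act_cocycle _ (der_act_cocycle _ cj)) j'w.
  rewrite -QP (_ : _ *m Q = w *m (M *m (P *m Q) *m (P *m Q))); last by rewrite !mulmxA.
  rewrite PQ !MM => bw; apply: cohomologous_trans qjx.
  apply: (@der_act_cohomologous _ _ _ q n _ (der_act j x)) => //.
    by do 5!apply: der_act_cocycle.
  by apply: cohomologous_trans bw (cohomologous_sym wP).
pose a := der_comp (der_comp p' u) i; pose b := der_comp (der_comp p v) i'.
have [ee e'e'] := (proj2 (repI X sX), proj2 (repI X' sX')).
have [c cba _] := der_iso_of_act (half _ _ _ _ _ _ _ _ u v _ _ pi ip ip' ee uU vV UV VU).
have [d _ abd] := der_iso_of_act (half _ _ _ _ _ _ _ _ v u _ _ pi' ip' ip e'e' vV uU VU UV).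
exists a, (der_comp b d); split.
  have bd : der_eq (der_comp b d) (der_comp c b).
    apply: der_eq_trans (der_eq_sym (der_eq_1l _)) _.
    apply: der_eq_trans (der_eq_comp (der_eq_sym cba) (der_eq_refl _)) _.
    apply: der_eq_trans (der_eq_sym (der_eq_assoc _ _ _)) _.
    apply: der_eq_comp (der_eq_refl _) _.
    apply: der_eq_trans (der_eq_sym (der_eq_assoc _ _ _)) _.
    apply: der_eq_trans (der_eq_1r _); apply: der_eq_comp (der_eq_refl _) _.
    exact: der_eq_trans (der_eq_assoc _ _ _) abd.
  apply: der_eq_trans (der_eq_comp bd (der_eq_refl _)) _.
  exact: der_eq_trans (der_eq_sym (der_eq_assoc _ _ _)) cba.
exact: der_eq_trans (der_eq_assoc _ _ _) abd.
Qed.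
End Summands.

Section DerIso.
Variable A : pzRingType.
Implicit Types X Y Z : bcomplex A.

Lemma der_isomorphic_refl X : der_isomorphic X X.
Proof. by exists (der_id X), (der_id X); split; apply: der_eq_1l. Qed.

Lemma der_isomorphic_sym X Y : der_isomorphic X Y -> der_isomorphic Y X.
Proof. by move=> [u [v [? ?]]]; exists v, u. Qed.

Lemma der_retract_comp X Y Z (u : der_hom X Y) (v : der_hom Y X)
    (u' : der_hom Y Z) (v' : der_hom Z Y) :
  der_eq (der_comp v u) (der_id X) -> der_eq (der_comp v' u') (der_id Y) ->
  der_eq (der_comp (der_comp v v') (der_comp u' u)) (der_id X).
Proof.
move=> vu vu'; apply: der_eq_trans (der_eq_sym (der_eq_assoc _ _ _)) _.
apply: der_eq_trans vu; apply: der_eq_comp (der_eq_refl _) _.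
apply: der_eq_trans (der_eq_assoc _ _ _) _.
by apply: der_eq_trans (der_eq_1l _); apply: der_eq_comp (der_eq_refl _).
Qed.

Lemma der_isomorphic_trans X Y Z :
  der_isomorphic X Y -> der_isomorphic Y Z -> der_isomorphic X Z.
Proof.
move=> [u [v [vu uv]]] [u' [v' [vu' uv']]].
by exists (der_comp u' u), (der_comp v v'); split; apply: der_retract_comp.
Qed.

Lemma quasi_iso_der_isomorphic X Y (s : chain_map X Y) :
  quasi_iso s -> der_isomorphic X Y.
Proof.
by move=> qs; exists (der_map s), (der_inv qs); split;
  [apply: der_eq_invl|apply: der_eq_invr].
Qed.
End DerIso.

Lemma der_summand_isomorphic (k : fieldType) (A : falgType k) (X Z Z' : bcomplex A) :
  der_summand X Z -> der_isomorphic Z Z' -> der_summand X Z'.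
Proof.
move=> [i [p pi]] [u [v [vu _]]]; exists (der_comp u i), (der_comp p v).
exact: der_retract_comp.
Qed.

Lemma chain_retract_summand (k : fieldType) (A : falgType k) (X Z : bcomplex A)
    (i : chain_map X Z) (p : chain_map Z X) :
  (forall n x, p n (i n x) = x) -> der_summand X Z.
Proof.
move=> pi; exists (der_map i), (der_map p).
apply: der_eq_trans (der_eq_sym (der_eq_map_comp _ _)) _.
by apply/der_eq_homotopic/homotopic_eq => n x; apply: pi.
Qed.

(** * Functors on complexes *)

Section ComplexFunctor.
Variables (A B : pzRingType) (F : functor (fgmod_cat A) (fgmod_cat B)).

Definition fun_ob (M : fgmod A) : fgmod B := fob F M.

Definition fun_map (M N : fgmod A) (f : {linear M -> N}) :
  {linear fun_ob M -> fun_ob N} := @fmap _ _ F M N f.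

Definition additive_functor := forall (M N : fgmod A) (f g : {linear M -> N}) x,
  fun_map (f \+ g) x = fun_map f x + fun_map g x.

Hypothesis Fadd : additive_functor.

Lemma fun_map_eq (M N : fgmod A) (f g : {linear M -> N}) :
  f =1 g -> fun_map f =1 fun_map g.
Proof. by move=> /linear_eq->. Qed.

Lemma fun_map1 (M : fgmod A) x : fun_map (idfun : {linear M -> M}) x = x.
Proof. by rewrite /fun_map (fmap1 F M). Qed.

Lemma fun_map_comp (M N P : fgmod A) (f : {linear M -> N}) (g : {linear N -> P}) x :
  fun_map (g \o f) x = fun_map g (fun_map f x).
Proof. by rewrite /fun_map (@fmap_comp _ _ F M N P f g). Qed.

Lemma fun_map0 (M N : fgmod A) (f : {linear M -> N}) :
  (forall x, f x = 0) -> forall x, fun_map f x = 0.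
Proof.
move=> f0 x; have e : fun_map f x = fun_map (f \+ f) x.
  by apply: fun_map_eq => y /=; rewrite f0 addr0.
apply/eqP; move/eqP: e.
by rewrite Fadd -subr_eq0 opprD addrA subrr sub0r oppr_eq0.
Qed.

Definition fun_complex (X : bcomplex A) : bcomplex B.
Proof.
refine (@BComplex B (fun i => fun_ob (X i)) (fun i j => fun_map (diff X i j)) _ _ _).
- by move=> i j ij; apply: fun_map0; apply: diff_shape.
- move=> i j l x; rewrite -fun_map_comp; apply: fun_map0 => y; exact: diffK.
- have [n nP] := cbounded X; exists n => i /nP Xi x.
  rewrite -[x]fun_map1; apply: fun_map0 => y; exact: Xi.
Defined.

Definition fun_chain (X Y : bcomplex A) (f : chain_map X Y) :
  chain_map (fun_complex X) (fun_complex Y).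
Proof.
refine (@ChainMap B (fun_complex X) (fun_complex Y) (fun i => fun_map (f i)) _) => i j x.
by rewrite /= -!fun_map_comp; apply: fun_map_eq => y; apply: cmap_diff.
Defined.

Lemma fun_homotopic (X Y : bcomplex A) (f g : chain_map X Y) :
  homotopic f g -> homotopic (fun_chain f) (fun_chain g).
Proof.
move=> [h hP]; exists (fun i j => fun_map (h i j)) => i x.
rewrite /= -!fun_map_comp -Fadd; apply/eqP; rewrite subr_eq addrC -Fadd; apply/eqP.
by apply: fun_map_eq => y /=; rewrite -hP addrC subrK.
Qed.

Hypothesis Fexact : forall (X Y : bcomplex A) (s : chain_map X Y),
  quasi_iso s -> quasi_iso (fun_chain s).

Fixpoint fun_der X Y (u : der_hom X Y) : der_hom (fun_complex X) (fun_complex Y) :=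
  match u with
  | der_map _ _ f => der_map (fun_chain f)
  | der_inv _ _ _ qs => der_inv (Fexact qs)
  | der_comp _ _ _ v u => der_comp (fun_der v) (fun_der u)
  end.

Lemma fun_der_eq X Y (u v : der_hom X Y) :
  der_eq u v -> der_eq (fun_der u) (fun_der v).
Proof.
have id1 Z : der_eq (der_map (fun_chain (chain_id Z))) (der_id (fun_complex Z)).
  by apply/der_eq_homotopic/homotopic_eq => i x; apply: fun_map1.
elim=> {X Y u v} /=.
- by move=> *; apply: der_eq_refl.
- by move=> X Y u v _; apply: der_eq_sym.
- by move=> X Y u v w _ uv _; apply: der_eq_trans.
- by move=> X Y Z v v' u u' _ IH _ IH'; apply: der_eq_comp.
- by move=> *; apply: der_eq_assoc.
- move=> X Y u; apply: der_eq_trans (der_eq_1l _).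
  exact: der_eq_comp (id1 _) (der_eq_refl _).
- move=> X Y u; apply: der_eq_trans (der_eq_1r _).
  exact: der_eq_comp (der_eq_refl _) (id1 _).
- move=> X Y Z g f; apply: der_eq_trans (der_eq_map_comp _ _).
  by apply/der_eq_homotopic/homotopic_eq => i x; apply: fun_map_comp.
- by move=> X Y f g /fun_homotopic/der_eq_homotopic.
- by move=> X Y s qs; apply: der_eq_trans (der_eq_sym (id1 _)); apply: der_eq_invl.
- by move=> X Y s qs; apply: der_eq_trans (der_eq_sym (id1 _)); apply: der_eq_invr.
Qed.

Lemma fun_der_isomorphic X Y :
  der_isomorphic X Y -> der_isomorphic (fun_complex X) (fun_complex Y).
Proof.
have id1 Z : der_eq (der_map (fun_chain (chain_id Z))) (der_id (fun_complex Z)).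
  by apply/der_eq_homotopic/homotopic_eq => i x; apply: fun_map1.
move=> [u [v [vu uv]]]; exists (fun_der u), (fun_der v); split.
  exact: der_eq_trans (fun_der_eq vu) (id1 _).
exact: der_eq_trans (fun_der_eq uv) (id1 _).
Qed.
End ComplexFunctor.

(** * Extension and restriction of scalars *)

Section TensorLift.
Variables (A B : pzRingType) (phi : {rmorphism A -> B}) (M : lmodType A).
Variables (V : zmodType) (beta : B -> M -> V).
Hypothesis betaDl : forall b b' m, beta (b + b') m = beta b m + beta b' m.
Hypothesis betaDr : forall b m m', beta b (m + m') = beta b m + beta b m'.
Hypothesis beta_bal : forall b a m, beta (b * phi a) m = beta b (a *: m).

Lemma tensor_eq_lift s t : tensor_eq phi s t ->
  \sum_(p <- s) beta p.1 p.2 = \sum_(p <- t) beta p.1 p.2.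
Proof.
elim=> {s t} //.
- by move=> t s u _ -> _ ->.
- by move=> s s' t t' _ es _ et; rewrite !big_cat es et.
- by move=> s t; rewrite !big_cat /= addrC.
- move=> m; rewrite big_seq1 big_nil /=; apply: (addrI (beta 0 m)).
  by rewrite -betaDl !addr0.
- by move=> b b' m; rewrite !big_cons !big_nil !addr0 betaDl.
- by move=> b m m'; rewrite !big_cons !big_nil !addr0 betaDr.
- by move=> b a m; rewrite !big_seq1 beta_bal.
Qed.

Definition tensor_lift (x : tensor phi M) : V :=
  \sum_(p <- repr x) beta p.1 p.2.

Lemma tensor_liftE s :
  tensor_lift (\pi_(tensor phi M)%qT s) = \sum_(p <- s) beta p.1 p.2.
Proof. exact/tensor_eq_lift/tensor_repr. Qed.

Lemma tensor_liftD x y : tensor_lift (x + y) = tensor_lift x + tensor_lift y.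
Proof.
elim/tensorW: x => s; elim/tensorW: y => t.
by rewrite {1}/GRing.add /= tensor_addE !tensor_liftE big_cat.
Qed.

Lemma tensor_lift0 : tensor_lift 0 = 0.
Proof. by apply: (addrI (tensor_lift 0)); rewrite -tensor_liftD !addr0. Qed.

Lemma tensor_lift_pure b m : tensor_lift (pure phi b m) = beta b m.
Proof. by rewrite tensor_liftE big_seq1. Qed.
End TensorLift.

Lemma tensor_ind (A B : pzRingType) (phi : {rmorphism A -> B}) (M : lmodType A)
    (P : tensor phi M -> Prop) :
  P 0 -> (forall x y, P x -> P y -> P (x + y)) -> (forall b m, P (pure phi b m)) ->
  forall x, P x.
Proof.
move=> P0 PD Pp; elim/tensorW => s; rewrite pi_tensor_sum.
by apply: big_ind => // p _; apply: Pp.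
Qed.

Lemma pure0l (A B : pzRingType) (phi : {rmorphism A -> B}) (M : lmodType A) (m : M) :
  pure phi 0 m = 0.
Proof. by apply: (addrI (pure phi 0 m)); rewrite -pureDl !addr0. Qed.

Lemma pure0r (A B : pzRingType) (phi : {rmorphism A -> B}) (M : lmodType A) b :
  pure phi b (0 : M) = 0.
Proof. by apply: (addrI (pure phi b 0)); rewrite -pureDr !addr0. Qed.

Lemma tensor_map_pure (A B : pzRingType) (phi : {rmorphism A -> B})
    (M N : lmodType A) (f : {linear M -> N}) b m :
  tensor_map f (pure phi b m) = pure phi b (f m).
Proof. by rewrite tensor_mapE. Qed.

Section Extension.
Variables (k : fieldType) (A B : falgType k) (phi : {lrmorphism A -> B}).

Local Notation G := (restrict_functor phi).
Local Notation F := (tensor_functor phi).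

Lemma restrict_additive : additive_functor G.
Proof. by []. Qed.

Lemma tensor_additive : additive_functor F.
Proof.
move=> M N f g; elim/tensorW => s.
rewrite -[LHS]/(@tensor_map _ _ phi M N (f \+ g) _).
rewrite -[RHS]/(@tensor_map _ _ phi M N f _ + @tensor_map _ _ phi M N g _).
rewrite !tensor_mapE !pi_tensor_sum !big_map /= -big_split /=.
by apply: eq_bigr => p _; rewrite pureDr.
Qed.

Lemma restrict_exact (X Y : bcomplex B) (s : chain_map X Y) :
  quasi_iso s -> quasi_iso (fun_chain restrict_additive s).
Proof. exact. Qed.

Lemma restrict_cohomology_dim (X : bcomplex B) i n :
  cohomology_dim X i n -> cohomology_dim (fun_complex restrict_additive X) i n.
Proof.
move=> [z [zc zP]]; exists z; split=> // x cx.
have sE (c : {ffun 'I_n -> k}) :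
    \sum_(s < n) ((c s)%:A : A) *: (z s : Defs.restrict phi (X i)) =
    \sum_(s < n) ((c s)%:A : B) *: z s.
  apply: eq_bigr => s _; rewrite restrict_scaleE.
  by apply: (congr1 (fun y : B => y *: z s)); rewrite /= linearZ rmorph1.
have [c [c1 c2]] := zP x cx; exists c; split.
  by move: c1; rewrite -sE.
by move=> c' c'1; apply: c2; rewrite -sE.
Qed.

Lemma tensor_unit_linear (M : fgmod A) :
  linear (fun m : M => pure phi 1 m : fob G (fob F M)).
Proof.
move=> a m m'; rewrite pureDr; congr (_ + _).
by rewrite -pure_bal mul1r -[RHS]/(phi a *: pure phi 1 m) pure_scale mulr1.
Qed.

Definition tensor_unit (M : fgmod A) : {linear M -> fob G (fob F M)} :=
  pack_linear (@tensor_unit_linear M).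

Section Counit.
Variable N : fgmod B.

Let act (b : B) (m : Defs.restrict phi N) : N := b *: (m : N).

Let actDl b b' m : act (b + b') m = act b m + act b' m.
Proof. exact: scalerDl. Qed.

Let actDr b m m' : act b (m + m') = act b m + act b m'.
Proof. exact: scalerDr. Qed.

Let act_bal b a m : act (b * phi a) m = act b (a *: m).
Proof. by rewrite /act restrict_scaleE scalerA. Qed.

Lemma tensor_counit_linear : linear (tensor_lift act : fob F (fob G N) -> N).
Proof.
move=> b x y; rewrite tensor_liftD //; congr (_ + _).
elim/tensor_ind: x => [|x x' IH IH'|c m].
- by rewrite scaler0 tensor_lift0 // scaler0.
- by rewrite scalerDr !tensor_liftD // scalerDr IH IH'.
- by rewrite pure_scale !tensor_lift_pure // /act scalerA.
Qed.

Definition tensor_counit : {linear fob F (fob G N) -> N} :=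
  pack_linear tensor_counit_linear.

Lemma tensor_counit_pure b m : tensor_counit (pure phi b m) = b *: (m : N).
Proof. exact: tensor_lift_pure. Qed.
End Counit.

(* Rafael's criterion: [tensor_functor] is separable iff the unit of the
   adjunction is a naturally split monomorphism, and [restrict_functor] is
   separable iff the counit is a naturally split epimorphism. *)
Lemma split_unit : split_extension phi ->
  exists d : forall M : fgmod A, {linear fob G (fob F M) -> M},
    (forall M m, d M (tensor_unit M m) = m) /\
    (forall (M N : fgmod A) (f : {linear M -> N}) x,
       d N (fun_map G (fun_map F f) x) = f (d M x)).
Proof.
move=> [H [Hnat H1]].
pose d (M : fgmod A) : {linear fob G (fob F M) -> M} :=
  H (fob G (fob F M)) M (tensor_counit (fob F M)).
have dE (M N P : fgmod A) (g : {linear M -> P}) (f : {linear N -> fob G (fob F M)})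
    (h : {linear fob F N -> fob F P}) :
    (forall x, fun_map F g (tensor_counit (fob F M) (fun_map F f x)) = h x) ->
    forall x, g (d M (f x)) = (H N P h : {linear N -> P}) x.
  move=> E x; have := Hnat (fob G (fob F M)) N M P f g (tensor_counit (fob F M)).
  set lhs := (X in H _ _ X) => e; have -> : h = lhs by apply: linear_eq => y; rewrite -E.
  by rewrite e.
exists d; split.
  move=> M m; rewrite -[LHS]/(idfun _).
  rewrite (dE M M M idfun (tensor_unit M) (fmap F (@idm (fgmod_cat A) M))).
    by rewrite H1.
  elim/tensor_ind => [|x y ex ey|b x]; first by rewrite !linear0.
    by rewrite !linearD ex ey.
  rewrite -[fun_map F (tensor_unit M) _]/(tensor_map _ _) tensor_map_pure.
  rewrite tensor_counit_pure pure_scale mulr1.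
  by rewrite fmap1 -[LHS]/(tensor_map _ _) tensor_map_pure.
move=> M N f x; pose h : {linear fob F (fob G (fob F M)) -> fob F N} :=
  fun_map F f \o tensor_counit (fob F M).
rewrite [RHS](dE M (fob G (fob F M)) N f idfun h).
  rewrite -[LHS]/(idfun _) (dE N (fob G (fob F M)) N idfun (fun_map G (fun_map F f)) h) //.
  elim/tensor_ind => [|y z ey ez|b y]; first by rewrite !linear0.
    by rewrite !linearD ey ez.
  rewrite fun_map1.
  rewrite -[fun_map F (fun_map G (fun_map F f)) _]/(tensor_map _ _) tensor_map_pure.
  rewrite -[RHS]/(fun_map F f (tensor_counit _ (pure phi b y))).
  by rewrite !tensor_counit_pure linearZ.
by move=> y; rewrite fun_map1.
Qed.

Lemma separable_counit : separable_extension phi ->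
  exists s : forall N : fgmod B, {linear N -> fob F (fob G N)},
    (forall N y, tensor_counit N (s N y) = y) /\
    (forall (M N : fgmod B) (f : {linear M -> N}) x,
       fun_map F (fun_map G f) (s M x) = s N (f x)).
Proof.
move=> [H [Hnat H1]].
pose s (N : fgmod B) : {linear N -> fob F (fob G N)} :=
  H N (fob F (fob G N)) (tensor_unit (fob G N)).
have sE (N M P : fgmod B) (g : {linear fob F (fob G N) -> P}) (f : {linear M -> N})
    (h : {linear fob G M -> fob G P}) :
    (forall x, fun_map G g (tensor_unit (fob G N) (fun_map G f x)) = h x) ->
    forall x, g (s N (f x)) = (H M P h : {linear M -> P}) x.
  move=> E x; have := Hnat N M (fob F (fob G N)) P f g (tensor_unit (fob G N)).
  set lhs := (X in H _ _ X) => e; have -> : h = lhs by apply: linear_eq => y; rewrite -E.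
  by rewrite e.
exists s; split.
  move=> N y; rewrite -[s N y]/(s N (idfun y)).
  rewrite (sE N N N (tensor_counit N) idfun (fmap G (@idm (fgmod_cat B) N))); first by rewrite H1.
  move=> x; rewrite -[LHS]/(tensor_counit N (pure phi 1 x)) tensor_counit_pure.
  by rewrite scale1r.
move=> M N f x; pose h : {linear fob G M -> fob G (fob F (fob G N))} :=
  tensor_unit (fob G N) \o fun_map G f.
rewrite [RHS](sE N M _ idfun f h) // -[s M x]/(s M (idfun x)).
rewrite (sE M M _ (fun_map F (fun_map G f)) idfun h) // => y.
by rewrite -[LHS]/(tensor_map (fun_map G f) (pure phi 1 y)) tensor_map_pure.
Qed.

Lemma split_summand (X : bcomplex A) : split_extension phi ->
  der_summand X (fun_complex restrict_additive (fun_complex tensor_additive X)).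
Proof.
move=> /split_unit[d [d1 dn]].
pose Z := fun_complex restrict_additive (fun_complex tensor_additive X).
have i0 i j x : tensor_unit (X j) (diff X i j x) = diff Z i j (tensor_unit (X i) x).
  by rewrite -[RHS]/(tensor_map _ (pure phi 1 x)) tensor_map_pure.
have p0 i j x : d (X j) (diff Z i j x) = diff X i j (d (X i) x) by exact: dn.
apply: (chain_retract_summand (i := @ChainMap _ X Z _ i0)
  (p := @ChainMap _ Z X _ p0)) => n x.
exact: d1.
Qed.

Lemma separable_summand (X : bcomplex B) : separable_extension phi ->
  der_summand X (fun_complex tensor_additive (fun_complex restrict_additive X)).
Proof.
move=> /separable_counit[s [s1 sn]].
pose Z := fun_complex tensor_additive (fun_complex restrict_additive X).
have i0 i j x : s (X j) (diff X i j x) = diff Z i j (s (X i) x) by rewrite -sn.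
have p0 i j x : tensor_counit (X j) (diff Z i j x) = diff X i j (tensor_counit (X i) x).
  elim/tensor_ind: x => [|x y ex ey|b m]; first by rewrite !linear0.
    by rewrite !linearD ex ey.
  rewrite -[diff Z i j _]/(tensor_map _ _) tensor_map_pure !tensor_counit_pure.
  by rewrite linearZ.
apply: (chain_retract_summand (i := @ChainMap _ X Z _ i0)
  (p := @ChainMap _ Z X _ p0)) => n x.
exact: s1.
Qed.

Lemma dual_basis : projective (right_regular phi) ->
  exists n (b : 'I_n -> B) (f : 'I_n -> B -> A),
    [/\ forall j x y, f j (x + y) = f j x + f j y,
        forall j x a, f j (x * phi a) = f j x * a &
        forall x, x = \sum_j b j * phi (f j x)].
Proof.
pose n : nat := \dim {:B}; pose b (j : 'I_n) : B := (vbasis {:B})`_j.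
pose g (v : 'rV[A^c]_n) : right_regular phi := \sum_j b j * phi (v 0 j).
have glin : linear g.
  move=> a v w; rewrite /g -[X in _ = X + _]/((\sum_j b j * phi (v 0 j)) * phi a).
  rewrite mulr_suml -big_split /=; apply: eq_bigr => j _.
  rewrite !mxE -[a * v 0 j]/((v 0 j : A) * (a : A)) rmorphD rmorphM mulrDr.
  by rewrite mulrA.
move=> /(_ _ _ (pack_linear glin) idfun)[].
  move=> y; exists (\row_j ((coord (vbasis {:B}) j y)%:A : A)).
  rewrite -[LHS]/(\sum_j b j * phi _) {2}(coord_vbasis (memvf y)).
  by apply: eq_bigr => j _; rewrite mxE linearZ rmorph1 -scalerAr mulr1.
move=> h hP; exists n, b, (fun j x => h x 0 j); split.
- by move=> j x y; rewrite linearD mxE.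
- move=> j x a; rewrite -[x * phi a]/((a : A^c) *: (x : right_regular phi)).
  by rewrite linearZ mxE.
- by move=> x; rewrite -{1}[x]/(idfun x) -hP.
Qed.

(* A dual basis of B over A exhibits the underlying group of [B (x)_A M] as a
   natural direct summand of a power of M. *)
Lemma tensor_exact : projective (right_regular phi) ->
  forall (X Y : bcomplex A) (s : chain_map X Y),
    quasi_iso s -> quasi_iso (fun_chain tensor_additive s).
Proof.
move=> /dual_basis[n [b [f [fD fM bf]]]] X Y s qs.
pose beta j (M : fgmod A) (x : B) (m : M) : M := f j x *: m.
have bDl j M x y m : beta j M (x + y) m = beta j M x m + beta j M y m.
  by rewrite /beta fD scalerDl.
have bDr j M x m m' : beta j M x (m + m') = beta j M x m + beta j M x m'.
  by rewrite /beta scalerDr.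
have bb j M x a m : beta j M (x * phi a) m = beta j M x (a *: m).
  by rewrite /beta fM scalerA.
pose iota j (M : fgmod A) : fob F M -> M := tensor_lift (beta j M).
have iD j M x y : iota j M (x + y) = iota j M x + iota j M y.
  exact: (tensor_liftD (bDl j M) (bDr j M) (bb j M)).
have i0 j M : iota j M 0 = 0.
  exact: (tensor_lift0 (bDl j M) (bDr j M) (bb j M)).
have ip j M c m : iota j M (pure phi c m) = f j c *: m.
  exact: (tensor_lift_pure (bDl j M) (bDr j M) (bb j M)).
have iN j (M N : fgmod A) (h : {linear M -> N}) x : iota j N (fun_map F h x) = h (iota j M x).
  elim/tensor_ind: x => [|x y ex ey|c m].
  - by rewrite !linear0 !i0 linear0.
  - by rewrite linearD !iD linearD ex ey.
  - rewrite -[fun_map F h _]/(tensor_map h _) tensor_map_pure.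
    by rewrite !ip linearZ.
pose p j (M : fgmod A) (m : M) : fob F M := pure phi (b j) m.
have pD j (M : fgmod A) : {morph p j M : x y / x + y} by move=> x y; apply: pureDr.
have p0 j (M : fgmod A) : p j M 0 = 0 by apply: pure0r.
have pB j (M : fgmod A) x y : p j M (x - y) = p j M x - p j M y.
  by apply: (addIr (p j M y)); rewrite -pD !subrK.
have pN j (M N : fgmod A) (h : {linear M -> N}) m : fun_map F h (p j M m) = p j N (h m).
  by rewrite -[LHS]/(tensor_map h _) tensor_map_pure.
have pi (M : fgmod A) x : x = \sum_j p j M (iota j M x).
  elim/tensor_ind: x => [|x y ex ey|c m].
  - by rewrite big1 // => j _; rewrite i0 p0.
  - by rewrite {1}ex {1}ey -big_split; apply: eq_bigr => j _; rewrite iD pD.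
  - rewrite {1}(bf c) (big_morph _ (pureDl phi m) (pure0l _ m)).
    by apply: eq_bigr => j _; rewrite pure_bal ip.
have ic (Z : bcomplex A) j i (x : fun_complex tensor_additive Z i) :
    cocycle x -> cocycle (iota j (Z i) x).
  move=> cx; rewrite /cocycle -iN.
  by rewrite (cx : fun_map F (diff Z i (i + 1)) x = 0) i0.
have ib (Z : bcomplex A) j i (x : fun_complex tensor_additive Z i) :
    coboundary x -> coboundary (iota j (Z i) x).
  by move=> [y ->]; exists (iota j _ y); rewrite -iN.
have pc (Z : bcomplex A) j i (x : Z i) : cocycle x ->
    cocycle (p j (Z i) x : fun_complex tensor_additive Z i).
  move=> cx; rewrite /cocycle -[LHS]/(fun_map F (diff Z i (i + 1)) (p j _ x)).
  by rewrite pN (cx : diff Z i (i + 1) x = 0) p0.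
have pb (Z : bcomplex A) j i (x : Z i) : coboundary x ->
    coboundary (p j (Z i) x : fun_complex tensor_additive Z i).
  by move=> [y ->]; exists (p j _ y); rewrite -pN.
have [s1 s2] := iffLR (quasi_isoP s) qs.
apply/quasi_isoP; split=> i.
  move=> x cx sx; rewrite [x]pi; apply: big_ind => [|y z|j _].
  - exact: coboundary0.
  - exact: coboundaryD.
  - apply/pb/s1; first exact: ic.
    by rewrite -iN; apply: (ib Y).
move=> y cy.
have [w wP] : {w : 'I_n -> X i & forall j,
    cocycle (w j) /\ cohomologous (iota j (Y i) y) (s i (w j))}.
  apply: (@choice _ _ (fun j x => cocycle x /\ cohomologous (iota j (Y i) y) (s i x))) => j.
  by have [x cx yx] := s2 i _ (ic Y j i y cy); exists x.
exists (\sum_j p j (X i) (w j)).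
  apply: big_ind => [|u v|j _].
  - exact: cocycle0.
  - exact: cocycleD.
  - exact/pc/(proj1 (wP j)).
rewrite linear_sum /cohomologous {1}[y]pi -sumrB.
apply: big_ind => [|u v|j _].
- exact: coboundary0.
- exact: coboundaryD.
- rewrite -[fun_chain _ _ _ _]/(fun_map F (s i) (p j _ (w j))) pN -pB.
  exact: pb (proj2 (wP j)).
Qed.

Lemma kspanned_tensor (M : fgmod A) d : kspanned (fun _ : M => True) d ->
  kspanned (fun _ : fob F M => True) (d * \dim {:B}).
Proof.
move=> [g gP].
rewrite -[X in kspanned _ (X * _)]card_ord -[X in kspanned _ (_ * X)]card_ord -card_prod.
pose b := vbasis {:B}.
pose e (p : 'I_d * 'I_(\dim {:B})) : fob F M := pure phi b`_p.2 (g p.1).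
apply: (kspannedI (g := e)) => x _; elim/tensor_ind: x => [|x y [c ->] [c' ->]|a m].
- by exists (fun=> 0); rewrite big1 // => p _; rewrite scale0r scale0r.
- exists (fun p => c p + c' p); rewrite -big_split; apply: eq_bigr => p _.
  by rewrite scalerDl scalerDl.
have [c mE] := gP m I.
exists (fun p => c p.1 * coord b p.2 a).
rewrite -(pair_big predT predT (fun i j => (c i * coord b j a)%:A *: e (i, j))) /=.
rewrite mE (big_morph _ (pureDr phi a) (pure0r _ _ a)); apply: eq_bigr => i _.
rewrite -pure_bal (_ : a * _ = \sum_j (c i * coord b j a) *: b`_j).
  rewrite (big_morph _ (pureDl phi (g i)) (pure0l _ (g i))); apply: eq_bigr => j _.
  by rewrite /e pure_scale mulr_algl.
rewrite /= linearZ rmorph1 -scalerAr mulr1 {1}(coord_vbasis (memvf a)) scaler_sumr.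
by apply: eq_bigr => j _; rewrite scalerA.
Qed.
End Extension.

(** * Subcomplexes *)

Section Submodules.
Variables (A : pzRingType) (M : lmodType A).

Record submod := Submod {
  in_submod :> M -> Prop;
  in_submod0 : in_submod 0;
  in_submodP : forall a x y, in_submod x -> in_submod y -> in_submod (a *: x + y) }.

Definition submod_pred (U : submod) : {pred M} := fun x => `[< U x >].

Lemma submod_pred_closed U : submod_closed (submod_pred U).
Proof.
split; first by apply/asboolP; apply: in_submod0.
by move=> a x y /asboolP Ux /asboolP Uy; apply/asboolP/in_submodP.
Qed.

HB.instance Definition _ (U : submod) :=
  GRing.isSubmodClosed.Build A M (submod_pred U) (submod_pred_closed U).

Record subm (U : submod) := SubM { subm_val : M; subm_valP : subm_val \in submod_pred U }.

HB.instance Definition _ U := [isSub for @subm_val U].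
HB.instance Definition _ U := [Choice of subm U by <:].
HB.instance Definition _ U := [SubChoice_isSubLmodule of subm U by <:].

Lemma in_subm (U : submod) (x : subm U) : U (val x).
Proof. exact/asboolP/subm_valP. Qed.

Definition to_subm (U : submod) (x : M) (Ux : U x) : subm U := SubM (asboolT Ux).
End Submodules.

Section SubmodFinite.
Variables (k : fieldType) (A : falgType k) (M : lmodType A) (U : submod M).

Lemma ksubspace_submod : ksubspace U.
Proof. by split=> [|c x y]; [apply: in_submod0|apply: in_submodP]. Qed.

Lemma kspanned_subm d : kspanned U d -> kspanned (fun _ : subm U => True) d.
Proof.
move=> Ud; have [||n [z [nd zU zP]]] :=
    quotient_basis ksubspace_submod (B := fun x => x = 0) _ _ Ud.
- by split=> // c x y -> ->; rewrite scaler0 addr0.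
- by move=> x ->; apply: in_submod0.
apply: (kspanned_leq nd); exists (fun s => to_subm (zU s)) => x _.
have [c [xE _]] := zP _ (in_subm x); exists c; apply: val_inj.
rewrite raddf_sum /=; apply/eqP; rewrite -subr_eq0; apply/eqP.
by rewrite -[RHS]xE; congr (_ - _); apply: eq_bigr => s _; rewrite linearZ.
Qed.

Lemma finitely_generated_subm : finitely_generated M -> finitely_generated (subm U).
Proof.
move=> /finitely_generated_kspanned[d Md].
have [g gP] := kspanned_subm (kspanned_sub (fun _ _ => I) Md).
by exists d, g => x; have [c ->] := gP x I; exists (fun s => (c s)%:A).
Qed.
End SubmodFinite.

Section SubComplex.
Variables (k : fieldType) (A : falgType k) (X : bcomplex A).
Variable U : forall i, submod (X i).
Hypothesis Ud : forall i j x, U i x -> U j (diff X i j x).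

Definition sub_obj i : fgmod A := FgMod (finitely_generated_subm (U i) (fgmodP (X i))).

Lemma sub_diff_linear i j :
  linear (fun x : sub_obj i => to_subm (Ud j (in_subm x)) : sub_obj j).
Proof. by move=> a x y; apply: val_inj; rewrite /= linearP. Qed.

Lemma subm_val_linear i : linear (@subm_val A (X i) (U i) : sub_obj i -> X i).
Proof. by move=> a x y; rewrite -[LHS]/(val _) linearP. Qed.

Definition sub_complex : bcomplex A.
Proof.
refine (@BComplex A sub_obj (fun i j => pack_linear (@sub_diff_linear i j)) _ _ _).
- by move=> i j ij x; apply: val_inj; rewrite /= diff_shape.
- by move=> i j l x; apply: val_inj; rewrite /= diffK.
- have [n nP] := cbounded X; exists n => i /nP Xi x; apply: val_inj; exact: Xi.
Defined.

Definition sub_incl : chain_map sub_complex X.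
Proof.
by refine (@ChainMap A sub_complex X (fun i => pack_linear (@subm_val_linear i)) _).
Defined.
End SubComplex.

Section Truncation.
Variables (k : fieldType) (A : falgType k).

Lemma chain_zero_subproof (X Y : bcomplex A) i j (x : X i) :
  (\0 : {linear X j -> Y j}) (diff X i j x) = diff Y i j ((\0 : {linear X i -> Y i}) x).
Proof. by rewrite /= linear0. Qed.

Definition chain_zero (X Y : bcomplex A) : chain_map X Y :=
  ChainMap (@chain_zero_subproof X Y).

(* The truncation above degree [a] replaces the degree [a - 1] term by the
   coboundaries of degree [a]; it is a subcomplex of a cone, so that no
   quotient module is needed. *)
Lemma truncation (X : bcomplex A) (a : int) :
  (forall i (x : X i), i < a -> cocycle x -> coboundary x) ->
  exists (T : bcomplex A) (p : chain_map X T), quasi_iso p /\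
    forall i, i + 1 < a -> forall x : T i, x = 0.
Proof.
move=> Xa; pose C := cone (chain_id X) (chain_zero X X).
pose U i (x : C i) := [/\ x.1.2 = 0, i < a -> x.1.1 = 0, i + 1 <> a -> x.2 = 0 &
  coboundary x.2].
have U0 i : U i 0 by split=> //; apply: coboundary0.
have UP i b x y : U i x -> U i y -> U i (b *: x + y).
  move=> [x1 x2 x3 x4] [y1 y2 y3 y4]; split.
  - by rewrite /= x1 y1 scaler0 addr0.
  - by move=> ia; rewrite /= x2 // y2 // scaler0 addr0.
  - by move=> ia; rewrite /= x3 // y3 // scaler0 addr0.
  - by apply: coboundaryD => //; apply: coboundaryZ.
pose V i : submod (C i) := Submod (U0 i) (UP i).
have Vd i j x : V i x -> V j (diff C i j x).
  have [->|ij] := eqVneq j (i + 1); last by rewrite diff_shape // => _; apply: U0.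
  move=> [x1 x2 x3 x4]; split=> /=.
  - by rewrite x1 !linear0 addr0.
  - move=> ia; rewrite x2 ?linear0 ?x3 ?linear0 ?addr0 //; lia.
  - by rewrite (coboundary_cocycle x4) oppr0.
  - by rewrite (coboundary_cocycle x4) oppr0; apply: coboundary0.
pose pf i (x : X i) : C i :=
  ((if a <= i then x else 0, 0), if i + 1 == a then diff X i (i + 1) x else 0).
have pU i x : V i (pf i x).
  split=> //=.
  - by case: ifP => //; lia.
  - by case: ifP => // /eqP.
  - by case: ifP => _; [apply: coboundary_diff|apply: coboundary0].
have plin i : linear (fun x => to_subm (pU i x)).
  move=> b x y; apply: val_inj; rewrite linearP /= /pf.
  congr (_, _, _); rewrite /= ?scaler0 ?addr0 //; case: ifP => _ //.
  - by rewrite scaler0 addr0.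
  - by rewrite linearP.
  - by rewrite scaler0 addr0.
have pd i j x : pack_linear (plin j) (diff X i j x) =
    diff (sub_complex Vd) i j (pack_linear (plin i) x).
  apply: val_inj => /=; rewrite /pf /cone_diff_fun /=.
  congr (_, _, _).
  - have [ij|ij] := eqVneq j (i + 1); last first.
      rewrite (diff_shape ij) (diff_shape ij) idx_cast_neq 1?eq_sym // addr0.
      by case: ifP.
    subst j; rewrite idx_cast_id.
    case: ifP => a1; case: ifP => a2; case: ifP => a3;
      by [rewrite ?linear0 ?addr0 ?add0r|lia].
  - by rewrite !linear0 addr0.
  - by case: ifP => _; case: ifP => _; rewrite ?diffK ?linear0 ?oppr0.
pose p := @ChainMap _ X (sub_complex Vd) _ pd; exists (sub_complex Vd), p; split; last first.
  move=> i ia x; apply: val_inj; have [x1 x2 x3 x4] := in_subm x.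
  move: x1 x2 x3; case: (val x) => [[u v] w] /= -> -> => [->//|]; lia.
apply/quasi_isoP; split=> i.
  move=> x cx /coboundaryP[j [y /(congr1 val)]].
  have [y1 _ _ y4] := in_subm y.
  rewrite /= /pf; case: ifP => [ai [-> _ _]|/negbT ia _]; last first.
    by apply: Xa => //; lia.
  apply: coboundaryD; first exact: coboundary_diff.
  exact: coboundary_idx_cast.
move=> y; have [y1 y2 y3 y4] := in_subm y => /(congr1 val) cy.
have {cy} cy : diff X i (i + 1) (val y).1.1 + (val y).2 = 0.
  by move: cy => /(congr1 (fun z : C (i + 1) => z.1.1)); rewrite /= idx_cast_id.
have [ia|ai] := boolP (i < a).
  exists 0; first exact: cocycle0.
  suff -> : y = 0 by rewrite linear0; apply: cohomologous_refl.
  apply: val_inj; move: y1 (y2 ia) cy; case: (val y) => [[u v] w] /= -> ->.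
  by rewrite linear0 add0r => ->.
have w0 : (val y).2 = 0 by apply: y3; lia.
exists (val y).1.1; first by move: cy; rewrite w0 addr0.
suff e : y = p i (val y).1.1 by rewrite {1}e; apply: cohomologous_refl.
apply: val_inj; move: y1 w0; case: (val y) => [[u v] w] /= -> ->.
rewrite /pf ifT; last lia.
by rewrite ifF //; apply/eqP; lia.
Qed.
End Truncation.

Section SubmodGenerated.
Variables (A : pzRingType) (M : lmodType A).

Lemma in_submod_sum (U : submod M) n (f : 'I_n -> M) :
  (forall s, U (f s)) -> U (\sum_(s < n) f s).
Proof.
move=> Uf; apply: big_ind => [|x y Ux Uy|//]; first exact: in_submod0.
by rewrite -[x]scale1r; apply: in_submodP.
Qed.

Lemma in_submodZ (U : submod M) a x : U x -> U (a *: x).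
Proof. by move=> Ux; rewrite -[_ *: _]addr0; apply: in_submodP => //; apply: in_submod0. Qed.

Lemma zero_submodP a (x y : M) : x = 0 -> y = 0 -> a *: x + y = 0.
Proof. by move=> -> ->; rewrite scaler0 addr0. Qed.

Definition zero_submod : submod M := Submod (erefl 0) zero_submodP.

Variables (n : nat) (g : 'I_n -> M).

Let generated (x : M) := exists a : 'I_n -> A, x = \sum_(s < n) a s *: g s.

Let generated0 : generated 0.
Proof. by exists (fun=> 0); rewrite big1 // => s _; rewrite scale0r. Qed.

Let generatedP c x y : generated x -> generated y -> generated (c *: x + y).
Proof.
move=> [a ->] [b ->]; exists (fun s => c * a s + b s).
by rewrite scaler_sumr -big_split /=; apply: eq_bigr => s _; rewrite scalerA -scalerDl.
Qed.

Definition generated_submod : submod M := Submod generated0 generatedP.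

Lemma generator_in_submod s : generated_submod (g s).
Proof.
exists (fun t => if t == s then 1 else 0).
rewrite (bigD1 s) //= eqxx scale1r big1 ?addr0 // => t /negbTE ->.
exact: scale0r.
Qed.
End SubmodGenerated.

Lemma descending_choice (T : int -> Type) (R : forall i, T (i + 1) -> T i -> Prop)
    (b : int) (base : forall i, T i) :
  (forall i t, i <= b -> exists t', R i t t') ->
  exists U : forall i, T i, (forall i, b < i -> U i = base i) /\
    (forall i, i <= b -> R i (U (i + 1)) (U i)).
Proof.
move=> ex; have {}ex i t : exists t', i <= b -> R i t t'.
  have [ib|ib] := boolP (i <= b); last by exists (base i).
  by have [t' tt'] := ex i t ib; exists t'.
pose step (V : forall i, T i) i : T i := projT1 (cid (ex i (V (i + 1)))).
pose N (i : int) : nat := if i <= b then absz (b + 1 - i)%R else 0%N.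
exists (fun i => iter (N i) step base i); split=> i ib.
  by rewrite /N ifF //; lia.
have -> : N i = (N (i + 1)).+1 by rewrite /N ib; case: ifP; lia.
exact: (projT2 (cid (ex i _))).
Qed.

Section Small.
Variables (k : fieldType) (A : falgType k).

Lemma cohomology_dim0 (X : bcomplex A) i (x : X i) :
  cohomology_dim X i 0 -> cocycle x -> coboundary x.
Proof.
by move=> [z [_ zP]] /zP[c [+ _]]; rewrite big_ord0 subr0.
Qed.

Lemma cohomology_dim_quasi_iso (X Y : bcomplex A) (f : chain_map X Y) i n :
  quasi_iso f -> cohomology_dim X i n -> cohomology_dim Y i n.
Proof.
move=> /quasi_isoP[f1 f2] [z [zc zP]]; exists (fun s => f i (z s)); split.
  by move=> s; apply: cocycle_cmap.
move=> y /f2[x cx yx]; have [c [cP cu]] := zP x cx.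
have fsum (c' : {ffun 'I_n -> k}) : f i (x - \sum_(s < n) (c' s)%:A *: z s) =
    f i x - \sum_(s < n) (c' s)%:A *: f i (z s).
  by rewrite linearB linear_sum; congr (_ - _); apply: eq_bigr => s _; rewrite linearZ.
exists c; split.
  have := coboundaryD yx (coboundary_cmap f cP).
  by rewrite fsum addrA subrK.
move=> c' c'P; apply: cu; apply: f1.
  apply: cocycleB => //; apply: big_ind => [|u v|s _].
  - exact: cocycle0.
  - exact: cocycleD.
  - exact: cocycleZ.
rewrite fsum; have := coboundaryD (coboundaryN yx) c'P.
by rewrite opprB addrA subrK.
Qed.

(* Generating, from the top degree downwards, by lifts of a basis of the
   cohomology and by preimages of a basis of the coboundaries already present. *)
Lemma small_subcomplex (X : bcomplex A) (n D : int -> nat) (b : int) :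
  (forall i, cohomology_dim X i (n i)) -> (forall i, b < i -> n i = 0%N) ->
  (forall i, i <= b -> ((n i + D (i + 1)%R) * \dim {:A} <= D i)%N) ->
  exists (Y : bcomplex A) (s : chain_map Y X), [/\ quasi_iso s,
    forall i, kspanned (fun _ : Y i => True) (D i),
    forall i, b < i -> forall y : Y i, y = 0 &
    forall i, (forall x : X i, x = 0) -> forall y : Y i, y = 0].
Proof.
move=> Xn nb DP.
pose T i := {U : submod (X i) | kspanned U (D i)}.
have zs i : kspanned (zero_submod (X i)) (D i).
  by exists (fun=> 0) => x ->; exists (fun=> 0); rewrite big1 // => s _; rewrite scaler0.
pose R i (t : T (i + 1)) (t' : T i) := [/\
  forall x, sval t' x -> sval t (diff X i (i + 1) x),
  forall x, sval t x -> coboundary x -> exists2 y, sval t' y & x = diff X i (i + 1) y &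
  forall x : X i, cocycle x -> exists2 y, sval t' y & cohomologous x y].
have step i (t : T (i + 1)) : i <= b -> exists t', R i t t'.
  move=> ib; case: t => U UD.
  have [||||m [y [md yU yP]]] := quotient_basis (C := fun x => U x /\ coboundary x)
    (B := fun x => x = 0) _ _ _ (kspanned_sub _ UD).
  - split=> [|c x y [Ux bx] [Uy By]]; first by split; [apply: in_submod0|apply: coboundary0].
    by split; [apply: in_submodP|apply/coboundaryD => //; apply: coboundaryZ].
  - by split=> // c x y -> ->; rewrite scaler0 addr0.
  - by move=> x ->; split; [apply: in_submod0|apply: coboundary0].
  - by move=> x [].
  have [w wP] : {w : 'I_m -> X i & forall t, y t = diff X i (i + 1) (w t)}.
    apply: (@choice _ _ (fun t w => y t = diff X i (i + 1) w)) => t.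
    exact: coboundary_at (erefl _) (proj2 (yU t)).
  have [z [zc zP]] := Xn i.
  pose g (s : 'I_(n i + m)) : X i := match fintype.split s with inl s => z s | inr t => w t end.
  pose V := generated_submod g.
  have zV s : V (z s).
    have := generator_in_submod g (lshift m s).
    by rewrite /g (unsplitK (inl s : 'I_(n i) + 'I_m)).
  have wV t : V (w t).
    have := generator_in_submod g (rshift (n i) t).
    by rewrite /g (unsplitK (inr t : 'I_(n i) + 'I_m)).
  have VD : kspanned V (D i).
    apply: kspanned_leq (kspanned_generated g).
    by apply: leq_trans (DP i ib); rewrite leq_mul2r leq_add2l md orbT.
  exists (exist _ V VD); split=> /=.
  - move=> _ [a ->]; rewrite linear_sum; apply: in_submod_sum => s.
    rewrite linearZ; apply: in_submodZ; rewrite /g.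
    case: fintype.split => [t|t]; first by rewrite (zc t); apply: in_submod0.
    by rewrite -wP; apply: (proj1 (yU t)).
  - move=> x Ux bx; have [c [/eqP + _]] := yP x (conj Ux bx).
    rewrite subr_eq0 => /eqP ->; exists (\sum_(s < m) (c s)%:A *: w s).
      by apply: (in_submod_sum (U := V)) => s; apply: in_submodZ.
    by rewrite linear_sum; apply: eq_bigr => s _; rewrite wP linearZ.
  - move=> x /zP[c [cP _]]; exists (\sum_(s < n i) (c s)%:A *: z s) => //.
    by apply: (in_submod_sum (U := V)) => s; apply: in_submodZ.
pose zero i : T i := exist (fun U : submod (X i) => kspanned U (D i)) _ (zs i).
have [t [tb tR]] := descending_choice zero step.
pose U i := sval (t i).
have U0 i x : b < i -> U i x -> x = 0 by move=> /tb; rewrite /U => -> /=.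
have Ud i j x : U i x -> U j (diff X i j x).
  have [->|ij] := eqVneq j (i + 1); last by rewrite diff_shape // => _; apply: in_submod0.
  have [ib|ib] := boolP (i <= b); first by have [+ _ _] := tR i ib; apply.
  move=> /U0->; last lia; rewrite linear0; exact: in_submod0.
exists (sub_complex Ud), (sub_incl Ud); split.
- apply/quasi_isoP; split=> i.
    move=> x /(congr1 val) cx bx.
    have [ib|ib] := boolP (i - 1 <= b); last first.
      suff -> : x = 0 by apply: coboundary0.
      by apply: val_inj; apply: (U0 i) (in_subm x); lia.
    have S2 l : l = i - 1 + 1 -> forall u, U l u -> coboundary u ->
        exists2 v, U (i - 1) v & u = diff X (i - 1) l v.
      by move=> ->; have [_ + _] := tR _ ib.
    have [|v Uv xE] := S2 i _ (val x) (in_subm x) bx; first by rewrite subrK.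
    by exists (to_subm Uv); apply: val_inj.
  move=> y cy; have [ib|ib] := boolP (i <= b).
    have [_ _ S1] := tR _ ib; have [x Ux yx] := S1 y cy.
    exists (to_subm Ux) => //; apply: val_inj.
    by have := cocycleB cy (coboundary_cocycle yx); rewrite opprB addrC subrK.
  exists 0; first exact: cocycle0.
  rewrite /cohomologous (linear0 (sub_incl Ud i)) subr0; apply: cohomology_dim0 cy.
  by rewrite -(nb i) //; lia.
- by move=> i; apply: kspanned_subm; apply: (svalP (t i)).
- by move=> i ib y; apply: val_inj; apply: (U0 i) (in_subm y).
- by move=> i Xi y; apply: val_inj; apply: Xi.
Qed.
End Small.

(** * Derived-discrete algebras *)

Section Discrete.
Variables (k : fieldType) (A : falgType k).

Definition has_dim_vector (n : int -> nat) (X : bcomplex A) :=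
  forall i, cohomology_dim X i (n i).

Lemma derived_discreteP : derived_discrete A <->
  forall n : int -> nat, finite_set [set i | n i != 0%N]%classic ->
    finitely_many (has_dim_vector n) (@der_isomorphic A).
Proof.
split=> dA n fn.
  have [m [C CP]] := dA n fn.
  have [c cP] : {c : bcomplex A -> option 'I_m & forall X, has_dim_vector n X ->
      exists2 s, c X = Some s & iso_class X = C s}.
    apply: (@choice _ _ (fun X c => has_dim_vector n X ->
      exists2 s, c = Some s & iso_class X = C s)) => X.
    have [/CP[s XC]|nX] := pselect (has_dim_vector n X); last by exists None.
    by exists (Some s) => _; exists s.
  exists (option 'I_m), c => X Y /cP[s -> Xs] /cP[t -> Yt] [st].
  have e : iso_class X = iso_class Y by rewrite Xs Yt st.
  rewrite -[der_isomorphic X Y]/(iso_class X Y) e; exact: der_isomorphic_refl.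
have [I [c cP]] := dA n fn.
exists #|I|, (fun s Y => exists X, [/\ has_dim_vector n X, c X = enum_val s &
  der_isomorphic X Y]) => X Xn.
exists (enum_rank (c X)); apply/funext => Y; apply/propext; split=> [XY|].
  by exists X; rewrite enum_rankK.
move=> [X' [X'n + X'Y]]; rewrite enum_rankK => cX.
exact: der_isomorphic_trans (cP X X' Xn X'n (esym cX)) X'Y.
Qed.

Lemma finite_support_bound (n : int -> nat) :
  finite_set [set i | n i != 0%N]%classic ->
  exists b : nat, forall i : int, b%:Z < `|i| -> n i = 0%N.
Proof.
move=> /finite_seqP[s sE]; exists (\sum_(i <- s) absz i)%N => i ib.
apply/eqP; apply: contraTT ib => ni.
have si : i \in s by have : [set i | n i != 0%N]%classic i; [|rewrite sE].
rewrite (big_rem i si) /=; lia.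
Qed.

Lemma bounded_support_finite (n : int -> nat) (b : nat) :
  (forall i : int, b%:Z < `|i| -> n i = 0%N) ->
  finite_set [set i | n i != 0%N]%classic.
Proof.
move=> nb; pose s : seq int := [seq j%:Z - b%:Z | j <- iota 0 (b + b).+1].
apply: (@sub_finite_set _ _ [set` s]); last exact: finite_seq.
move=> i /= ni; have ib : ~~ (b%:Z < `|i|) by apply: contra ni => /nb->.
by apply/mapP; exists (absz (i + b%:Z)%R); rewrite ?mem_iota; lia.
Qed.

Lemma kspanned_zero (M : lmodType A) d :
  (forall x : M, x = 0) -> kspanned (fun _ : M => True) d.
Proof.
move=> M0; exists (fun=> 0) => x _; exists (fun=> 0).
by rewrite (M0 x) big1 // => s _; rewrite scaler0.
Qed.

Definition small_complex (b d : nat) (V : bcomplex A) :=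
  (forall i : int, b%:Z < `|i| -> forall y : V i, y = 0) /\
  (forall i, kspanned (fun _ : V i => True) d).

Lemma small_representative (n : int -> nat) :
  finite_set [set i | n i != 0%N]%classic ->
  exists b d, forall X : bcomplex A, has_dim_vector n X ->
    exists2 V, der_isomorphic X V & small_complex b d V.
Proof.
move=> /finite_support_bound[b nb].
have [|D [_ DP]] := @descending_choice (fun=> nat)
  (fun i d d' => d' = (n i + d) * \dim {:A})%N b%:Z (fun=> 0%N).
  by move=> i d _; exists ((n i + d) * \dim {:A})%N.
exists b.+1, (\sum_(j < (b + b).+2) D (j%:Z - b.+1%:Z)%R)%N => X Xn.
have [|T [p [qp T0]]] := @truncation _ _ X (- b%:Z).
  move=> i x ib; apply: cohomology_dim0; rewrite -(nb i) //; lia.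
have Tn i : cohomology_dim T i (n i) by apply: cohomology_dim_quasi_iso qp (Xn i).
have [|i ib|V [s [qs VD Vb VT]]] := @small_subcomplex _ _ T n D b%:Z Tn.
- by move=> i ib; apply: nb; lia.
- by rewrite -(DP i ib).
exists V.
  apply: der_isomorphic_trans (quasi_iso_der_isomorphic qp) _.
  exact/der_isomorphic_sym/(quasi_iso_der_isomorphic qs).
have V0 (i : int) : b.+1%:Z < `|i| -> forall y : V i, y = 0.
  move=> ib; have [bi|bi] := boolP (b%:Z < i); first exact: Vb.
  by apply: VT; apply: T0; lia.
split=> // i; have [ib|ib] := boolP (b.+1%:Z < `|i|).
  exact/kspanned_zero/V0.
have [ib'|ib'] := boolP (b%:Z < i); first exact/kspanned_zero/Vb.
have jb : (absz (i + b.+1%:Z)%R < (b + b).+2)%N by lia.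
apply: kspanned_leq (VD i); rewrite (bigD1 (Ordinal jb)) //=.
have -> : (absz (i + b.+1%:Z)%R)%:Z - b.+1%:Z = i by lia.
exact: leq_addr.
Qed.
End Discrete.

Section Main.
Variables (k : fieldType) (A B : falgType k) (phi : {lrmorphism A -> B}).

Lemma split_derived_discrete :
  split_extension phi -> derived_discrete B -> derived_discrete A.
Proof.
move=> sphi /derived_discreteP dB; apply/derived_discreteP => n fn.
have [b [d VP]] := small_representative A fn.
have [v vP] : {v : bcomplex A -> bcomplex A & forall X, has_dim_vector n X ->
    der_isomorphic X (v X) /\ small_complex b d (v X)}.
  apply: (@choice _ _ (fun X V => has_dim_vector n X ->
    der_isomorphic X V /\ small_complex b d V)) => X.
  have [/VP[V XV Vs]|nX] := pselect (has_dim_vector n X); last by exists X.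
  by exists V.
apply: (finitely_many_map (f := v) (P' := small_complex b d) (E' := @der_isomorphic A)).
- by move=> X /vP[].
- move=> X Y /vP[Xv _] /vP[Yv _] vv; apply: der_isomorphic_trans Xv _.
  exact: der_isomorphic_trans vv (der_isomorphic_sym Yv).
pose F := fun_complex (@tensor_additive k A B phi).
pose G := fun_complex (@restrict_additive k A B phi).
apply: (finitely_many_fiber (E' := fun V W => der_isomorphic (F V) (F W))).
  pose m := (d * \dim {:B})%N.
  pose n' (j : {ffun 'I_(b + b).+1 -> 'I_m.+1}) (i : int) : nat :=
    if b%:Z < `|i| then 0%N else j (inord (absz (i + b%:Z)%R)).
  apply: (finitely_many_union (Q := fun j V => has_dim_vector (n' j) (F V))).
    move=> V [V0 Vd].
    have [c cP] : {c : int -> nat & forall i, cohomology_dim (F V) i (c i) /\ (c i <= m)%N}.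
      apply: (@choice _ _ (fun i c => cohomology_dim (F V) i c /\ (c <= m)%N)) => i.
      by have [c cm cV] := cohomology_dim_le (X := F V) (kspanned_tensor phi (Vd i)); exists c.
    exists [ffun j : 'I__ => inord (c (j%:Z - b%:Z))] => i; rewrite /n'.
    case: ifPn => ib.
      have [|c0] := @cohomology_dim_le _ _ (F V) i 0.
        apply: (kspanned_tensor phi (d := 0)); apply: kspanned_zero; exact: V0.
      by rewrite leqn0 => /eqP->.
    have jb : (absz (i + b%:Z)%R < (b + b).+1)%N by lia.
    rewrite ffunE (inordK jb) inordK; last exact: (proj2 (cP _)).
    have -> : (absz (i + b%:Z)%R)%:Z - b%:Z = i by lia.
    exact: (proj1 (cP i)).
  move=> j; apply: (finitely_many_map (f := F) _ _ (dB (n' j) _)) => //.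
  by apply: (bounded_support_finite (b := b)) => i ib; rewrite /n' ib.
move=> V _; apply: (finitely_many_map (f := id) _ _ (finitely_many_summands (G (F V)))) => //.
move=> W [_ FVW]; apply: der_summand_isomorphic (split_summand W sphi) _.
apply: (fun_der_isomorphic (@restrict_exact _ _ _ phi)).
exact: der_isomorphic_sym.
Qed.

Lemma separable_derived_discrete :
  separable_extension phi -> projective (right_regular phi) ->
  derived_discrete A -> derived_discrete B.
Proof.
move=> sphi proj /derived_discreteP dA; apply/derived_discreteP => n fn.
pose F := fun_complex (@tensor_additive k A B phi).
pose G := fun_complex (@restrict_additive k A B phi).
apply: (finitely_many_fiber (E' := fun X Y => der_isomorphic (G X) (G Y))).
  apply: (finitely_many_map (f := G) _ _ (dA n fn)) => // X Xn i.
  exact: restrict_cohomology_dim.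
move=> X _; apply: (finitely_many_map (f := id) _ _ (finitely_many_summands (F (G X)))) => //.
move=> Y [_ GXY]; apply: der_summand_isomorphic (separable_summand Y sphi) _.
apply: (fun_der_isomorphic (tensor_exact proj)).
exact: der_isomorphic_sym.
Qed.
End Main.

Theorem theorem4p1 (k : fieldType) (A B : falgType k)
    (phi : {lrmorphism A -> B}) :
  infinite_set [set: k]%classic ->
  (split_extension phi -> derived_discrete B -> derived_discrete A)
  /\
  (separable_extension phi -> projective (right_regular phi) ->
   derived_discrete A -> derived_discrete B).
Proof.
move=> _; split; first exact: split_derived_discrete.
exact: separable_derived_discrete.
Qed.
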